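(* Let $n \ge 12$ be an integer and let $G \in \mathcal{U}_{n,3}$ be a graph with minimum spectral radius among all graphs in $\mathcal{U}_{n,3}$. Then: (1) if $n \equiv -1 \pmod 3$, then $G \cong G_2\left(\frac{n+1}{3}, \frac{n-14}{3}, \frac{n-5}{3}\right)$; (2) if $n \equiv 0 \pmod 3$, then $G \cong G_2\left(\frac{n}{3}, \frac{n-12}{3}, \frac{n-6}{3}\right)$ or $G \cong G_3\left(\frac{n-6}{3}, \frac{n-6}{3}, \frac{n-6}{3}\right)$; (3) if $n \equiv 1 \pmod 3$, then $G \cong G_2\left(\frac{n-1}{3}, \frac{n-10}{3}, \frac{n-7}{3}\right)$.
   Context: All graphs are finite and simple. The spectral radius $\rho(G)$ of a graph $G$ is the maximum absolute value of an eigenvalue of its adjacency matrix. A unicyclic graph is a connected graph containing exactly one cycle. The matching number is the maximum number of pairwise disjoint edges. $\mathcal{U}_{n,3}$ is the class of all connected unicyclic graphs on $n$ vertices with matching number $3$. ''Attaching $m$ pendant vertices to a vertex $v$'' means adding $m$ new vertices, each adjacent only to $v$. For nonnegative integers $a,b,c$: $G_2(a,b,c)$ is the graph on $a+b+c+6$ vertices obtained from the path $[v_1,v_2,v_3,v_4,v_5,v_6]$ by adding the edge $v_3v_6$ and then attaching $a$, $b$, $c$ pendant vertices to $v_1$, $v_3$, $v_5$, respectively. For nonnegative integers $a,b,c$, not all zero, $G_3(a,b,c)$ is the graph on $a+b+c+6$ vertices obtained from the $6$-cycle $[v_1,v_2,v_3,v_4,v_5,v_6,v_1]$ by attaching $a$,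 $b$, $c$ pendant vertices to $v_1$, $v_3$, $v_5$, respectively. $\cong$ denotes graph isomorphism. *)

(* Defs.v *)
From HB Require Import structures.
From mathcomp Require Import all_boot all_order all_algebra.
From mathcomp Require Import boolp classical_sets reals.

Set Implicit Arguments.
Unset Strict Implicit.
Unset Printing Implicit Defensive.

Import Order.TTheory GRing.Theory Num.Theory.

Record sgraph := SGraph {
  vertex :> finType;
  adj : rel vertex;
  adj_sym : symmetric adj;
  adj_irrefl : irreflexive adj
}.

Definition graph_iso (G H : sgraph) : Prop :=
  exists2 f : G -> H, bijective f & forall x y : G, adj (f x) (f y) = adj x y.

Definition edges (G : sgraph) : {set {set G}} :=
  [set [set x; y] | x in [set: G], y in [set: G] & adj x y].

Definition connected_graph (G : sgraph) : Prop :=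
  (0 < #|G|) /\ forall x y : G, connect (@adj G) x y.

(* A cycle is traversed by a cyclic sequence of pairwise distinct vertices.
   Such sequences differing by a rotation or a reversal describe the same cycle,
   so the cycle, as a subgraph, is identified with its set of edges. *)
Definition is_cycle (G : sgraph) (c : seq G) : bool :=
  (2 < size c) && ucycleb (@adj G) c.

Definition cycle_edges (G : sgraph) (c : seq G) : {set {set G}} :=
  [set [set x; next c x] | x in c].

Definition unicyclic (G : sgraph) : Prop :=
  connected_graph G /\
  exists2 c : seq G, is_cycle c &
    forall d : seq G, is_cycle d -> cycle_edges d = cycle_edges c.

Definition is_matching (G : sgraph) (M : {set {set G}}) : bool :=
  (M \subset edges G) && finset.trivIset M.

Definition matching_number (G : sgraph) : nat :=
  \max_(M : {set {set G}} | is_matching M) #|M|.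

Definition unicyclic_class (n m : nat) (G : sgraph) : Prop :=
  [/\ unicyclic G, #|G| = n & matching_number G = m].

Definition adjacency (R : pzSemiRingType) (G : sgraph) : 'M[R]_#|G| :=
  \matrix_(i, j) (adj (enum_val i) (enum_val j))%:R%R.

(* The adjacency matrix is real symmetric, so its eigenvalues are all real; for
   a nonempty graph they form a finite nonempty set and the supremum is a
   maximum. *)
Definition spectral_radius (R : realType) (G : sgraph) : R :=
  sup [set `|l|%R | l in [set l : R | eigenvalue (adjacency R G) l]].

Definition min_spectral_radius (R : realType) (P : sgraph -> Prop)
    (G : sgraph) : Prop :=
  P G /\ forall H, P H -> (spectral_radius R G <= spectral_radius R H)%R.

(* The ordinal i stands for the vertex v_(i+1). *)
Definition edge_list_adj (n : nat) (s : seq (nat * nat)) : rel 'I_n :=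
  fun x y => (x != y) && (((x.+1, y.+1) \in s) || ((y.+1, x.+1) \in s)).

Lemma edge_list_sym (n : nat) (s : seq (nat * nat)) :
  symmetric (@edge_list_adj n s).
Proof. by move=> x y; rewrite /edge_list_adj eq_sym orbC. Qed.

Lemma edge_list_irrefl (n : nat) (s : seq (nat * nat)) :
  irreflexive (@edge_list_adj n s).
Proof. by move=> x; rewrite /edge_list_adj eqxx. Qed.

Definition edge_list_graph (n : nat) (s : seq (nat * nat)) : sgraph :=
  SGraph (@edge_list_sym n s) (@edge_list_irrefl n s).

(* The pendant vertices attached to v are the pairs of v and an element of
   'I_(m v). *)
Definition pendant_adj (G : sgraph) (m : G -> nat) :
    rel (G + {v : G & 'I_(m v)})%type := fun x y =>
  match x, y with
  | inl u, inl v => adj u v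
  | inl u, inr p => u == tag p
  | inr p, inl u => u == tag p
  | inr _, inr _ => false
  end.

Lemma pendant_sym (G : sgraph) (m : G -> nat) : symmetric (@pendant_adj G m).
Proof. by move=> [u|p] [v|q] //=; exact: adj_sym. Qed.

Lemma pendant_irrefl (G : sgraph) (m : G -> nat) :
  irreflexive (@pendant_adj G m).
Proof. by move=> [u|p] //=; exact: adj_irrefl. Qed.

Definition attach_pendant (G : sgraph) (m : G -> nat) : sgraph :=
  SGraph (@pendant_sym G m) (@pendant_irrefl G m).

Definition at_v135 (a b c : nat) (v : 'I_6) : nat :=
  match v.+1 with 1 => a | 3 => b | 5 => c | _ => 0 end.

Definition P6_chord : sgraph :=
  edge_list_graph 6 [:: (1, 2); (2, 3); (3, 4); (4, 5); (5, 6); (3, 6)].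

Definition C6 : sgraph :=
  edge_list_graph 6 [:: (1, 2); (2, 3); (3, 4); (4, 5); (5, 6); (6, 1)].

Definition G2 (a b c : nat) : sgraph :=
  @attach_pendant P6_chord (at_v135 a b c).

Definition G3 (a b c : nat) : sgraph :=
  @attach_pendant C6 (at_v135 a b c).

(* Main.v *)
Require Import Defs.
From mathcomp Require Import all_boot all_order all_algebra.
From mathcomp Require Import boolp classical_sets reals.
From mathcomp Require Import fintype finset.
From mathcomp Require Import spectral sesquilinear complex.
From mathcomp Require Import ring lra zify.

Set Implicit Arguments.
Unset Strict Implicit.
Unset Printing Implicit Defensive.

Import Order.TTheory GRing.Theory Num.Theory.

(** Let t^2 be n/3 + 2, n/3 + 31/15 or n/3 + 247/120 according to n mod 3. A
    positive vector y with A y <= t y shows that the announced graph G2 has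
    spectral radius at most t, so a minimiser G does too, and then every test
    vector z satisfies z.Az <= t z.z.
    Deleting an edge st of the cycle leaves a forest, which by Koenig's theorem is
    covered by three vertices a, b, c. If these cover G, the vertices outside
    {a, b, c} form an independent set on which z is best chosen as (sum over the
    hub neighbours) / t; writing N_P for the number of outer vertices with hub
    neighbourhood P, small integer weights on a, b, c give linear inequalities in
    the N_P whose only solutions are those of G2 and G3, and the N_P determine G.
    Otherwise Koenig's theorem on G - {s, t} produces either a vertex of degree at
    least n - 5 > t^2, or a triangle and two hubs to which all other vertices are
    attached; both force a spectral radius larger than t. *)

(** * Spectral bounds *)

(** Suppose three pairwise nonadjacent hubs cover the graph. Eliminating the other vertices from the
    eigenvalue equation leaves a 3 by 3 matrix with eigenvalue [t ^+ 2]: hub degrees on the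
    diagonal, numbers of common neighbours off it. For n = 3m the all-ones vector is an eigenvector
    of value m + 2 for both targets, hence the tie. For n = 3m + 1 and n = 3m + 2 the top eigenvalue
    of the target is irrational, about m + 2.391 and m + 2.719, while the best graphs of type [G3]
    have m + 1 + sqrt 2 and m + 1 + sqrt 3. The thresholds m + 12/5 and m + 109/40 are rationals
    inside these narrow gaps, which turns every comparison of counts into integer arithmetic.
    Koenig's theorem fails in the presence of an odd cycle; hence the detour through a forest, and
    the graphs without a cover of three vertices. Unicyclicity enters through that forest, through
    connectedness and through the bound of at least n edges. *)

Section Rayleigh.
Import ComplexField.
Local Open Scope ring_scope.
Local Open Scope complex_scope.
Local Open Scope sesquilinear_scope.

(** The matrix is diagonalised unitarily over the complex numbers. Its diagonal entries are real
    because it is Hermitian, and as roots of the characteristic polynomial of [A] they are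
    eigenvalues of [A] over [R], so [lem] bounds each term of the diagonalised form. *)
Lemma symmetric_rayleigh_le (R : rcfType) (n : nat) (A : 'M[R]_n) (m : R)
    (v : 'rV[R]_n) : A^T = A -> (forall l, eigenvalue A l -> l <= m) ->
  (v *m A *m v^T) 0 0 <= m * (v *m v^T) 0 0.
Proof.
move=> symA lem.
pose f := real_complex R.
pose B := map_mx f A.
have hB : B \is hermsymmx.
  apply: realsym_hermsym.
    apply/is_hermitianmxP/matrixP => i j; rewrite expr0 scale1r !mxE /=.
    by rewrite -[in RHS]symA mxE.
  by apply/mxOverP => i j; rewrite mxE /= complex_real.
have nB := hermitian_normalmx hB.
have /mxOverP rd := hermitian_spectral_diag_real hB.
have /orthomx_spectralP defB := nB.
set P := spectralmx B in defB *; set d := spectral_diag B in defB rd *.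
have Pu : P \is unitarymx := spectral_unitarymx B.
have Punit : P \in unitmx := unitarymx_unit Pu.
have PB : P *m B = diag_mx d *m P by rewrite {1}defB !mulmxA mulmxV // mul1mx.
have led i : d 0 i <= f m.
  have /complex_realP[r dE] := rd 0 i.
  have : eigenvalue B (d 0 i).
    apply/eigenvalueP; exists (row i P).
      by rewrite -row_mul PB row_mul row_diag_mx -scalemxAl -rowE.
    apply/eqP => r0; have : row i P *m invmx P = 0 by rewrite r0 mul0mx.
    rewrite -row_mul mulmxV // => /rowP/(_ i); rewrite !mxE eqxx.
    by move/eqP; rewrite oner_eq0.
  rewrite eigenvalue_root_char dE -[r%:C]/(f r) -map_char_poly fmorph_root.
  by rewrite -eigenvalue_root_char => /lem; rewrite lecR.
have conjv : (map_mx f v)^t* = map_mx f v^T.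
  apply/matrixP => i j; rewrite !mxE /f /=.
  by rewrite /Num.conj /= oppr0.
pose w := map_mx f v *m P^t*.
have wE : w^t* = P *m map_mx f v^T.
  by rewrite /w trmx_mul map_mxM conjv trmxCK.
have Pinv : P^t* *m P = 1%:M by rewrite -invmx_unitary // mulVmx.
have sq : f ((v *m v^T) 0 0) = (w *m w^t*) 0 0.
  rewrite wE /w mulmxA -[_ *m _ *m P]mulmxA Pinv mulmx1.
  by rewrite -map_mxM [RHS]mxE.
have qf : f ((v *m A *m v^T) 0 0) = (w *m diag_mx d *m w^t*) 0 0.
  have -> : w *m diag_mx d *m w^t* = map_mx f (v *m A *m v^T).
    have BE : P^t* *m diag_mx d *m P = B by rewrite -invmx_unitary // [RHS]defB.
    by rewrite !map_mxM -/B -BE wE /w !mulmxA.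
  by rewrite [RHS]mxE.
have main : f ((v *m A *m v^T) 0 0) <= f (m * (v *m v^T) 0 0).
  have -> x y : f (x * y) = f x * f y by exact: rmorphM.
  rewrite sq qf !mxE mulr_sumr; apply: ler_sum => i _.
  rewrite mul_mx_diag !mxE -mulrA mulrCA.
  by rewrite ler_wpM2r // -normCK exprn_ge0.
by move: main; rewrite lecR.
Qed.

End Rayleigh.

Section SpectralRadius.
Local Open Scope ring_scope.
Variables (R : realType) (G : sgraph).

Lemma sum_enum_val (F : G -> R) : \sum_x F x = \sum_(i < #|G|) F (enum_val i).
Proof.
rewrite [RHS](reindex enum_rank); last by apply: onW_bij; exact: enum_rank_bij.
by apply: eq_bigr => x _; rewrite enum_rankK.
Qed.

Lemma eigenvalue_adjacencyP (l : R) :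
  reflect (exists2 v : G -> R, (exists x, v x != 0) &
             forall x, \sum_(y | adj x y) v y = l * v x)
          (eigenvalue (adjacency R G) l).
Proof.
apply: (iffP eigenvalueP) => [[v vA v0]|[v [x0 vx0] vA]].
  exists (fun x => v 0 (enum_rank x)).
    have [j vj] : exists j, v 0 j != 0.
      apply/existsP; apply: contraNT v0 => /existsPn v0.
      by apply/eqP/rowP => j; rewrite mxE; apply/eqP; move: (v0 j); rewrite negbK.
    by exists (enum_val j); rewrite enum_valK.
  move=> x; have /rowP/(_ (enum_rank x)) := vA; rewrite !mxE => <-.
  rewrite big_mkcond sum_enum_val; apply: eq_bigr => j _; rewrite mxE enum_valK enum_rankK.
  by rewrite adj_sym; case: adj; rewrite ?mulr1 ?mulr0.
exists (\row_j v (enum_val j)).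
  apply/rowP => i; rewrite !mxE -vA [RHS]big_mkcond [RHS]sum_enum_val.
  apply: eq_bigr => j _; rewrite !mxE adj_sym.
  by case: adj; rewrite ?mulr1 ?mulr0.
by apply: contraNneq vx0 => /rowP/(_ (enum_rank x0)); rewrite !mxE enum_rankK => ->.
Qed.

(** Collatz-Wielandt bound: the eigenvalue equation is read at a vertex maximising [|v x| / y x],
    where every neighbour satisfies [|v z| <= g x * y z]. *)
Lemma eigenvalue_adjacency_le (t : R) (y : G -> R) (l : R) :
  (forall x, 0 < y x) -> (forall x, \sum_(z | adj x z) y z <= t * y x) ->
  eigenvalue (adjacency R G) l -> `|l| <= t.
Proof.
move=> y_gt0 yt /eigenvalue_adjacencyP[v [x0 vx0] vA].
pose g x := `|v x| / y x.
case: (@arg_maxP _ _ _ x0 predT g isT) => x _ gx.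
have gx_gt0 : 0 < g x.
  by apply: lt_le_trans (gx x0 isT); rewrite divr_gt0 ?normr_gt0.
have leg z : `|v z| <= g x * y z by rewrite -ler_pdivrMr //; exact: gx.
have vxE : `|v x| = g x * y x by rewrite /g divfK ?gt_eqF.
have vx_gt0 : 0 < `|v x| by rewrite vxE mulr_gt0.
rewrite -(ler_pM2r vx_gt0) -normrM -vA.
apply: le_trans (ler_norm_sum _ _ _) _.
apply: le_trans (ler_sum _ (fun z _ => leg z)) _.
by rewrite -mulr_sumr vxE mulrCA ler_wpM2l // ltW.
Qed.

Lemma spectral_radius_le (t : R) (y : G -> R) : 0 <= t ->
  (forall x, 0 < y x) -> (forall x, \sum_(z | adj x z) y z <= t * y x) ->
  spectral_radius R G <= t.
Proof.
move=> t_ge0 y_gt0 yt; rewrite /spectral_radius; set E := (X in sup X).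
have ub : ubound E t.
  by move=> _ [l el <-]; exact: eigenvalue_adjacency_le y_gt0 yt el.
(* With no eigenvalue at all [sup] takes its default value 0, hence the hypothesis [0 <= t]. *)
have [->|ne] := eqVneq E classical_sets.set0; first by rewrite sup0.
by apply: sup_le_ub => //; apply/classical_sets.set0P.
Qed.

Lemma eigenvalue_le_spectral_radius (l : R) :
  eigenvalue (adjacency R G) l -> l <= spectral_radius R G.
Proof.
move=> el; apply: le_trans (ler_norm l) _.
apply: sup_upper_bound; last by exists l.
split; first by exists `|l|, l.
(* The supremum bounds its elements only if the set is bounded; constant weights show that the
   maximum degree, hence [#|G|], is a bound. *)
exists #|G|%:R => _ [m em <-].
apply: (@eigenvalue_adjacency_le _ (fun=> 1)) em => [//|x].
by rewrite mulr1 sumr_const ler_nat max_card.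
Qed.

Lemma rayleigh_le_spectral_radius (z : G -> R) :
  \sum_x \sum_(y | adj x y) z x * z y
    <= spectral_radius R G * \sum_x z x ^+ 2.
Proof.
pose v := \row_(j < #|G|) z (enum_val j).
have := @symmetric_rayleigh_le R _ (adjacency R G) (spectral_radius R G) v.
have -> : (v *m adjacency R G *m v^T) 0 0 = \sum_x \sum_(y | adj x y) z x * z y.
  under [RHS]eq_bigr do rewrite big_mkcond.
  rewrite !mxE exchange_big /= sum_enum_val; apply: eq_bigr => j _.
  rewrite !mxE mulr_suml sum_enum_val; apply: eq_bigr => i _; rewrite !mxE.
  by case: adj; rewrite ?mulr1 ?mulr0 ?mul0r.
have -> : (v *m v^T) 0 0 = \sum_x z x ^+ 2.
  by rewrite !mxE sum_enum_val; apply: eq_bigr => i _; rewrite !mxE expr2.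
apply; last exact: eigenvalue_le_spectral_radius.
by apply/matrixP => i j; rewrite !mxE adj_sym.
Qed.

End SpectralRadius.

Section IndependentRayleigh.
Local Open Scope ring_scope.
Variables (R : realType) (G : sgraph) (S : {set G}) (t : R) (x : G -> R).
Hypotheses (t_gt0 : 0 < t) (rho_le : spectral_radius R G <= t).
Hypothesis indS : {in S &, forall u v, ~~ adj u v}.
Hypothesis x0 : {in S, forall u, x u = 0}.

(* On the independent set S the test vector is extended by the values that
   maximise the Rayleigh form when the vector x is kept off S. *)
Lemma independent_rayleigh :
  \sum_(u in S) (\sum_(v | adj u v) x v) ^+ 2
    + t * \sum_u \sum_(v | adj u v) x u * x v <= t ^+ 2 * \sum_u x u ^+ 2.
Proof.
pose r u := \sum_(v | adj u v) x v.
pose s u := if u \in S then r u / t else 0.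
have := rayleigh_le_spectral_radius (fun u => x u + s u).
have sq : \sum_u (x u + s u) ^+ 2
          = \sum_u x u ^+ 2 + (\sum_(u in S) r u ^+ 2) / t ^+ 2.
  rewrite mulr_suml [X in _ + X]big_mkcond -big_split /=.
  apply: eq_bigr => u _; rewrite /s; case: ifP => uS; last by rewrite !addr0.
  by rewrite x0 // expr0n /= !add0r expr_div_n.
have xs : \sum_u \sum_(v | adj u v) s u * x v = (\sum_(u in S) r u ^+ 2) / t.
  rewrite mulr_suml [RHS]big_mkcond; apply: eq_bigr => u _.
  rewrite -mulr_sumr -/(r u) /s; case: ifP => _; last by rewrite mul0r.
  by rewrite expr2 mulrAC.
have sx : \sum_u \sum_(v | adj u v) x u * s v = (\sum_(u in S) r u ^+ 2) / t.
  rewrite -xs; under eq_bigr do rewrite big_mkcond.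
  rewrite exchange_big; apply: eq_bigr => u _; rewrite [RHS]big_mkcond /=.
  by apply: eq_bigr => v _; rewrite adj_sym mulrC.
have ss : \sum_u \sum_(v | adj u v) s u * s v = 0.
  apply: big1 => u _; apply: big1 => v uv; rewrite /s.
  case: ifP => uS; last by rewrite mul0r.
  case: ifP => vS; last by rewrite mulr0.
  by move: (indS uS vS); rewrite uv.
rewrite sq; set Q := \sum_u _.
have -> : Q = \sum_u \sum_(v | adj u v) x u * x v
              + (\sum_u \sum_(v | adj u v) s u * x v
                 + \sum_u \sum_(v | adj u v) x u * s v)
              + \sum_u \sum_(v | adj u v) s u * s v.
  rewrite -!big_split /=; apply: eq_bigr => u _; rewrite -!big_split /=.
  by apply: eq_bigr => v _; ring.
rewrite xs sx ss addr0 -mulr2n.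
set q := \sum_u _; set D := \sum_(u in S) _; set X := \sum_u _ => main.
have X0 : 0 <= X by apply: sumr_ge0 => u _; exact: sqr_ge0.
have D0 : 0 <= D by apply: sumr_ge0 => u _; exact: sqr_ge0.
(* The sum of squares is nonnegative, so the radius may be replaced by [t]. Multiplying by [t] and
   cancelling one [D] on each side gives the claim. *)
have le1 : q + D / t *+ 2 <= t * (X + D / t ^+ 2).
  apply: le_trans main _; apply: ler_wpM2r => //.
  by apply: addr_ge0 => //; rewrite divr_ge0 ?sqr_ge0.
have -> : t ^+ 2 * X = t * (t * (X + D / t ^+ 2)) - D.
  by field; rewrite gt_eqF.
have -> : D + t * q = t * (q + D / t *+ 2) - D by field; rewrite gt_eqF.
by rewrite lerD2r ler_wpM2l // ltW.
Qed.

End IndependentRayleigh.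

(** * Matchings, covers and forests *)

Section Matchings.
Variable G : sgraph.

Lemma edgesP (e : {set G}) :
  reflect (exists2 p : G * G, adj p.1 p.2 & e = [set p.1; p.2]) (e \in edges G).
Proof.
apply: (iffP imset2P) => [[x y _]|[[x y] /= xy ->]].
  by rewrite !inE /= => xy ->; exists (x, y).
by exists x y; rewrite ?inE.
Qed.

Lemma edges_adj (x y : G) : adj x y -> [set x; y] \in edges G.
Proof. by move=> xy; apply/edgesP; exists (x, y). Qed.

Lemma size_le_matching_number (ps : seq (G * G)) :
  all (fun p => adj p.1 p.2) ps ->
  uniq (flatten [seq [:: p.1; p.2] | p <- ps]) ->
  size ps <= matching_number G.
Proof.
move=> aps ups.
suff [M mM <-] : exists2 M : {set {set G}}, is_matching M & #|M| = size ps.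
  exact: (@leq_bigmax_cond _ (@is_matching G) (fun M => #|M|)).
(* Recording the covered vertices is what lets the induction see that the next pair is disjoint from
   [M]. *)
suff [M [mM <- _]] : exists M : {set {set G}},
    [/\ is_matching M, #|M| = size ps &
        cover M = [set x in flatten [seq [:: p.1; p.2] | p <- ps]]].
  by exists M.
elim: ps aps ups => [|[x y] ps IH] /=.
  move=> _ _; exists set0; rewrite cards0; split=> //.
    by rewrite /is_matching sub0set; apply/trivIsetP => A B; rewrite inE.
  by apply/setP => z; rewrite /cover big_set0 !inE.
case/andP => xy aps; rewrite !inE negb_or -andbA => /and4P[_ xps yps ups].
have [M [/andP[sM tM] cM cov]] := IH aps ups.
have dis B : B \in M -> [disjoint [set x; y] & B].
  move=> BM; rewrite -setI_eq0; apply/eqP/setP => z; rewrite !inE.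
  apply/negP => /andP[zxy zB].
  have : z \in cover M by apply/bigcupP; exists B.
  by rewrite cov inE; case/orP: zxy => /eqP ->; rewrite ?(negPf xps) ?(negPf yps).
have n0 : set0 \notin M.
  apply/negP => /(subsetP sM)/edgesP[[u v] _ /setP/(_ u)].
  by rewrite !inE eqxx.
have [tM' nM] := trivIsetU1 dis tM n0.
exists ([set x; y] |: M); split.
- rewrite /is_matching tM' andbT; apply/subsetP => e; rewrite !inE.
  by case/orP => [/eqP ->|/(subsetP sM)//]; exact: edges_adj.
- by rewrite cardsU1 nM cM.
- rewrite /cover big_setU1 //= -/(cover M) cov.
  by apply/setP => z; rewrite !inE -orbA.
Qed.

(** Choosing for each edge of a matching one of its ends in [C] is injective, the edges being
    disjoint. *)
Lemma matching_number_le_cover (C : {set G}) :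
  (forall x y, adj x y -> (x \in C) || (y \in C)) ->
  matching_number G <= #|C|.
Proof.
move=> covC; apply/bigmax_leqP => M /andP[sM /trivIsetP tM].
have [->|[e0 e0M]] := set_0Vmem M; first by rewrite cards0.
have /edgesP[[x0 y0] _ _] := subsetP sM _ e0M.
pose f (e : {set G}) := odflt x0 [pick x in e :&: C].
have fP e : e \in M -> f e \in e :&: C.
  move=> /(subsetP sM)/edgesP[[x y] /= xy ->]; rewrite /f.
  case: pickP => [z //|none].
  by case/orP: (covC _ _ xy) => h; [move: (none x) | move: (none y)];
     rewrite !inE eqxx h ?orbT.
rewrite -(card_in_imset (f := f)).
  apply/subset_leq_card/subsetP => _ /imsetP[e eM ->].
  by have := fP e eM; rewrite inE => /andP[].
move=> e e' eM e'M fE; apply: contraTeq isT => ne.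
have := tM _ _ eM e'M ne; rewrite -setI_eq0 => /eqP/setP/(_ (f e)).
have := fP e eM; have := fP e' e'M; rewrite -fE !inE.
by move=> /andP[-> _] /andP[-> _].
Qed.

End Matchings.

(** * Forests and Koenig's theorem *)

Section Forests.
Variables (T : finType) (r : rel T).
Hypotheses (r_sym : symmetric r) (r_irr : irreflexive r).

(** Acyclicity in the form of 1-degeneracy. Quantifying over all vertex sets makes it stable under
    the deletion of vertices. *)
Definition forest := forall A : {set T}, A != set0 ->
  exists2 x, x \in A & #|[set y in A | r x y]| <= 1.

(** Greedy argument: a vertex without neighbour in [A] is dropped; for a leaf [x] with neighbour
    [y], the cover takes [y], the matching takes the edge, and both ends are removed. Working inside
    [A] allows the use on the whole graph and on the complement of an edge. *)
Lemma konig_forest (A : {set T}) : forest ->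
  exists (C : {set T}) (ps : seq (T * T)),
    [/\ {in A &, forall x y, r x y -> (x \in C) || (y \in C)},
        C \subset A /\ all (fun p => r p.1 p.2) ps,
        uniq (flatten [seq [:: p.1; p.2] | p <- ps]),
        {subset flatten [seq [:: p.1; p.2] | p <- ps] <= A}
      & #|C| <= size ps].
Proof.
move=> fr; have [m] := ubnP #|A|; elim: m A => // m IH A; rewrite ltnS => Am.
have [->|A0] := eqVneq A set0.
  exists set0, [::]; split => //; rewrite ?cards0 ?sub0set //.
  by move=> x y; rewrite inE.
have [x xA dx] := fr A A0.
have [none|[y]] := set_0Vmem [set y in A | r x y].
  have nx y : y \in A -> r x y = false.
    by move=> yA; move/setP/(_ y): none; rewrite !inE yA.
  have [|C [ps [cov [sC aps] ups sps cC]]] := IH (A :\ x).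
    by apply: leq_trans Am; rewrite (cardsD1 x A) xA.
  exists C, ps; split => //.
  - move=> u v uA vA uv; apply: cov => //; rewrite !inE ?uA ?vA andbT.
      by apply/eqP => E; move: uv; rewrite E nx.
    by apply/eqP => E; move: uv; rewrite E r_sym nx.
  - by split=> //; apply: subset_trans sC (subsetDl _ _).
  - by move=> u /sps; rewrite inE => /andP[].
rewrite inE => /andP[yA xy].
have only z : z \in A -> r x z -> z = y.
  by move=> zA xz; apply: (card_le1_eqP dx); rewrite inE ?zA ?yA.
have xney : x != y by apply: contraTneq xy => ->; rewrite r_irr.
have [|C [ps [cov [sC aps] ups sps cC]]] := IH (A :\ x :\ y).
  apply: leq_trans Am; rewrite (cardsD1 x A) xA (cardsD1 y (A :\ x)).
  by rewrite !inE yA eq_sym xney add1n ltnS leq_addl.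
exists (y |: C), ((x, y) :: ps); split => /=.
- move=> u v uA vA uv; rewrite !inE.
  have [//|uy] := eqVneq u y; have [//|vy] := eqVneq v y; rewrite ?orbT //=.
  apply: cov => //; rewrite !inE ?uA ?vA ?uy ?vy andbT /=.
    by apply: contraNneq vy => E; move: uv; rewrite E => /only ->.
  by apply: contraNneq uy => E; move: uv; rewrite E r_sym => /only ->.
- rewrite xy; split => //; apply/subsetP => u; rewrite !inE.
  by case/orP => [/eqP -> //|/(subsetP sC)]; rewrite !inE => /and3P[].
- rewrite ups inE negb_or xney andbT /=.
  by apply/andP; split; apply/negP => /sps; rewrite !inE eqxx ?andbF.
- move=> u; rewrite !inE => /or3P[/eqP ->|/eqP ->|/sps] //.
  by rewrite !inE => /and3P[].
- by rewrite cardsU1 -add1n leq_add ?leq_b1.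
Qed.

(** If all degrees inside [A] were at least 2, the end [x] of a longest path in [A] would have all
    its neighbours on the path, and one of them would not be next to [x] on it. The edge to that one
    closes a cycle of length at least 3. *)
Lemma acyclic_forest :
  (forall c, 2 < size c -> uniq c -> ~~ cycle r c) -> forest.
Proof.
move=> acyc A /set0Pn[a aA]; apply/exists_inP.
apply: contraTT isT => /exists_inPn deg.
pose P k := [exists p : k.-tuple T,
  [&& uniq p, all (mem A) p & sorted r p]] && (0 < k).
have P1 : exists k, P k.
  by exists 1; rewrite /P andbT; apply/existsP; exists [tuple a]; rewrite /= aA.
have Pub k : P k -> k <= #|T|.
  by case/andP=> /existsP[p /and3P[/card_uniqP up _ _]] _;
     rewrite -[k](size_tuple p) -up max_card.
case: (ex_maxnP P1 Pub) => k /andP[/existsP[p /and3P[up Ap sp]] k0] kmax.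
case: p up Ap sp => -[|x p] /= sz; first by move: sz k0 => /eqP <-.
move=> /andP[xp up] /andP[xA Ap] sp.
have nbr y : y \in A -> r x y -> y \in p.
  move=> yA xy; apply: contraT => yp.
  have : P k.+1.
    rewrite /P andbT; apply/existsP.
    have sz' : size (y :: x :: p) == k.+1 by rewrite /= eqSS.
    exists (Tuple sz'); rewrite /= inE negb_or yp xp up yA xA Ap sp r_sym xy !andbT.
    by apply: contraTneq xy => ->; rewrite r_irr.
  by move/kmax; rewrite ltnn.
have : 1 < #|[set y in A | r x y]| by rewrite ltnNge deg.
rewrite (cardsD1 (head x p)) => /leq_ltn_trans.
case/(_ _ (leqnn _)) => // d1.
have : 0 < #|[set y in A | r x y] :\ head x p|.
  by move: d1; case: (_ \in _); rewrite ?add1n ?add0n // => /ltnW.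
rewrite card_gt0 => /set0Pn[y]; rewrite !inE => /and3P[yh yA xy].
have yp := nbr y yA xy.
case/splitPr: yp up sp xp yh => p1 p2 up sp xp yh.
have p1n : p1 != [::] by apply: contraNneq yh => ->.
have := acyc (x :: rcons p1 y).
rewrite /= size_rcons !ltnS lt0n size_eq0 p1n => /(_ isT).
move: up sp xp; rewrite -cat_rcons cat_uniq cat_path mem_cat negb_or.
move=> /andP[up _] /andP[sp _] /andP[xp _].
by rewrite xp up /= => /(_ isT); rewrite rcons_path sp last_rcons r_sym xy.
Qed.

End Forests.

(** * Connectedness, cycles and edge counts in unicyclic graphs *)

Section Unicyclic.
Variable G : sgraph.

Lemma connected_boundary (W : {set G}) (x y : G) : connected_graph G ->
  x \in W -> y \notin W -> exists u v, [/\ u \in W, v \notin W & adj u v].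
Proof.
move=> [_ conn] xW yW; apply: contrapT => none.
have cl : closed (@adj G) (mem W).
  apply: intro_closed => [|u v uv uW]; first exact/sym_connect_sym/adj_sym.
  by apply: contrapT => /negP vW; apply: none; exists u, v.
by have := closed_connect cl (conn x y); rewrite /= xW (negPf yW).
Qed.

(** A cycle avoiding the edge [s t] would have the same edge set as [c], which contains that
    edge. *)
Lemma unicyclic_edge_forest : unicyclic G -> exists s t : G,
  adj s t /\ forest (fun x y => adj x y && ([set x; y] != [set s; t])).
Proof.
move=> [_ [c /andP[sc /andP[cc uc]] uniqc]].
case: c sc cc uc uniqc => // s c sc cc uc uniqc.
have st := next_cycle cc (mem_head s c).
exists s, (next (s :: c) s); split => //; apply: acyclic_forest.
- by move=> x y; rewrite adj_sym setUC.
- by move=> x; rewrite adj_irrefl.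
- move=> d sd ud; apply/negP => rd.
  have cd : is_cycle d.
    rewrite /is_cycle sd /ucycleb ud andbT.
    by apply: sub_cycle rd => x y /andP[].
  have : [set s; next (s :: c) s] \in cycle_edges d.
    by rewrite (uniqc d cd); apply: imset_f; rewrite inE eqxx.
  case/imsetP => x xd E.
  by have := next_cycle rd xd; rewrite E eqxx andbF.
Qed.

Lemma next_next_neq (c : seq G) x : is_cycle c -> x \in c ->
  next c (next c x) != x.
Proof.
case/andP => sc /andP[cc uc] xc; have [i p cE] := rot_to xc.
have rN y : next c y = next (x :: p) y by rewrite -cE next_rot.
have : uniq (x :: p) by rewrite -cE rot_uniq.
have : 2 < size (x :: p) by rewrite -cE size_rot.
rewrite !rN; case: p {cE rN} => [|y [|z p]] //= _.
rewrite !inE !negb_or !eqxx => /andP[/and3P[xy xz xp] _].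
by rewrite [y == x]eq_sym (negPf xy) eq_sym.
Qed.

(** There are at least as many edges as vertices: a map [f] with [f x] adjacent to [x] and
    [f (f x) != x] sends distinct vertices [x] to distinct edges from [x] to [f x]. On the cycle [f]
    is the successor; a vertex newly reached from the domain is sent back to the vertex that reaches
    it. *)
Lemma unicyclic_sum_degrees : unicyclic G ->
  2 * #|G| <= \sum_(x : G) \sum_(y : G) adj x y.
Proof.
move=> [conn [c cyc _]]; have /andP[sc /andP[cc uc]] := cyc.
have x0 : {x0 | x0 \in c} by case: (c) sc => // x p _; exists x; rewrite inE eqxx.
case: x0 => x0 x0c.
pose good (W : {set G}) (f : G -> G) := forall x, x \in W ->
  [/\ f x \in W, adj x (f x) & f (f x) != x].
have [f fP] : exists f, good setT f.
  have: good [set x in c] (next c).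
    move=> x; rewrite !inE => xc; rewrite mem_next xc next_cycle //.
    by rewrite next_next_neq.
  have: x0 \in [set x in c] by rewrite inE.
  move: [set x in c] (next c) => W f.
  have [m] := ubnP #|~: W|; elim: m W f => // m IH W f; rewrite ltnS => Wm xW gW.
  have [WT|] := eqVneq W setT; first by exists f; rewrite -WT.
  rewrite -subTset => /subsetPn[y _ yW].
  have [u [v [uW vW uv]]] := connected_boundary conn xW yW.
  apply: (IH (v |: W) (fun z => if z == v then u else f z)).
  - apply: leq_trans Wm; rewrite setCU setIC -setDE.
    by rewrite [in X in _ < X](cardsD1 v) inE vW.
  - by rewrite !inE xW orbT.
  move=> z; rewrite !inE; have [-> _|zv /= zW] := eqVneq z v.
    rewrite uW orbT adj_sym uv; split => //.
    have [uE|_] := eqVneq u v; first by rewrite uE (negPf vW) in uW.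
    by apply: contraNneq vW => <-; have [] := gW u uW.
  have [fW zf ff] := gW z zW.
  rewrite fW orbT zf; split => //.
  by have [fE|_] := eqVneq (f z) v; first by rewrite fE (negPf vW) in fW.
have {fP} fP x : adj x (f x) /\ f (f x) != x by have [] := fP x (in_setT x).
have two : \sum_(x : G) \sum_(y : G) ((f x == y) + (f y == x)) = 2 * #|G|.
  have one : \sum_(x : G) \sum_(y : G) (f x == y) = #|G|.
    rewrite -sum1_card; apply: eq_bigr => x _.
    by rewrite (bigD1 (f x)) //= eqxx big1 // => y; rewrite eq_sym => /negPf ->.
  under eq_bigr do rewrite big_split /=.
  by rewrite big_split /= one exchange_big /= one mul2n addnn.
rewrite -two; apply: leq_sum => x _; apply: leq_sum => y _.
have [fx fyx] := fP x; have [<-|_] := eqVneq (f x) y.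
  by rewrite (negPf fyx) fx.
by have [<-|//] := eqVneq (f y) x; rewrite adj_sym (fP y).1.
Qed.

End Unicyclic.

(** Adjacency is a function of the colours, so any colour-preserving bijection is an isomorphism;
    [f] matches the enumerations of the colour classes, and [y0] is only the default of [nth]. *)
Lemma coloring_graph_iso (G H : sgraph) (I : finType) (r : rel I)
    (cG : G -> I) (cH : H -> I) (y0 : H) :
  (forall x y, adj x y = r (cG x) (cG y)) ->
  (forall x y, adj x y = r (cH x) (cH y)) ->
  (forall i, #|[set x | cG x == i]| = #|[set x | cH x == i]|) ->
  graph_iso G H.
Proof.
move=> rG rH cE.
pose FG i := enum [set x | cG x == i]; pose FH i := enum [set x | cH x == i].
have sF i : size (FG i) = size (FH i) by rewrite -!cardE.
pose f x := nth y0 (FH (cG x)) (index x (FG (cG x))).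
have ix x : index x (FG (cG x)) < size (FH (cG x)).
  by rewrite -sF index_mem mem_enum inE.
have cf x : cH (f x) = cG x.
  have := mem_nth y0 (ix x).
  by rewrite -/(f x) mem_enum inE => /eqP.
have injf : injective f.
  move=> x y fE; have cxy : cG x = cG y by rewrite -!cf fE.
  have := fE; rewrite /f -cxy => /eqP; rewrite nth_uniq ?enum_uniq //; last first.
    by rewrite cxy.
  move/eqP => iE; have xF : x \in FG (cG x) by rewrite mem_enum inE.
  have yF : y \in FG (cG x) by rewrite mem_enum inE cxy.
  by rewrite -(nth_index x xF) -[RHS](nth_index x yF) iE.
exists f; last by move=> x y; rewrite rH rG !cf.
apply: inj_card_bij => //.
have cardE (K : sgraph) (c : K -> I) : #|K| = \sum_i #|[set x | c x == i]|.
  rewrite -sum1_card (partition_big c predT) //=.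
  by apply: eq_bigr => i _; rewrite -sum1_card; apply: eq_bigl => x; rewrite inE.
by rewrite (cardE H cH) (cardE G cG); apply: leq_sum => i _; rewrite cE.
Qed.

(** * Graphs covered by three vertices *)

Section ThreeHubs.
Variables (G : sgraph) (a b c : G).

Definition hub_pattern (x : G) : bool * bool * bool := (adj x a, adj x b, adj x c).

Definition pattern_count (p : bool * bool * bool) : nat :=
  #|[set x | x \notin [:: a; b; c] & hub_pattern x == p]|.

Lemma sum_hub_pattern (V : nmodType) (F : bool * bool * bool -> V) :
  (\sum_(x | x \notin [:: a; b; c]) F (hub_pattern x)
    = \sum_p F p *+ pattern_count p)%R.
Proof.
rewrite (partition_big hub_pattern predT) //=; apply: eq_bigr => p _.
rewrite (eq_bigr (fun=> F p)) => [|x /andP[_ /eqP -> //]].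
by rewrite sumr_const; congr (_ *+ _)%R; apply: eq_card => x; rewrite inE.
Qed.

Lemma big_pattern (V : nmodType) (F : bool * bool * bool -> V) :
  (\sum_p F p = F (true, true, true) + F (true, true, false)
    + (F (true, false, true) + F (true, false, false))
    + (F (false, true, true) + F (false, true, false)
       + (F (false, false, true) + F (false, false, false))))%R.
Proof.
rewrite (eq_bigr (fun p => F (p.1.1, p.1.2, p.2))) => [|[[]] //].
rewrite -(pair_bigA _ (fun q i => F (q.1, q.2, i))) /=.
rewrite -(pair_bigA _ (fun i j => \sum_k F (i, j, k))%R) /=.
by rewrite !big_bool.
Qed.

Hypothesis abc : uniq [:: a; b; c].

Lemma sum_hubs (V : nmodType) (F : G -> V) :
  (\sum_x F x = F a + F b + F c + \sum_(x | x \notin [:: a; b; c]) F x)%R.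
Proof.
rewrite (bigID (mem [:: a; b; c])) /= -big_uniq //=.
by rewrite !big_cons big_nil addr0 addrA.
Qed.

Lemma card_pattern_count :
  #|G| = 3 + \sum_(p : bool * bool * bool) pattern_count p.
Proof.
rewrite -sum1_card (sum_hubs (fun=> 1)); congr (_ + _).
rewrite (sum_hub_pattern (fun=> 1)); apply: eq_bigr => p _.
by rewrite -[LHS]/(1 *+ _)%R natn.
Qed.

Hypothesis cover : forall x y, adj x y ->
  (x \in [:: a; b; c]) || (y \in [:: a; b; c]).

Lemma sum_nbr (V : nmodType) (F : G -> V) (x : G) : x \notin [:: a; b; c] ->
  (\sum_(y | adj x y) F y = F a *+ adj x a + F b *+ adj x b + F c *+ adj x c)%R.
Proof.
move=> xS; rewrite big_mkcond sum_hubs big1 ?addr0.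
  by do 3![case: adj; rewrite ?mulr1n ?mulr0n].
move=> y yS; case: ifP => // xy.
by move: (cover xy); rewrite (negPf xS) (negPf yS).
Qed.

Definition hub_edges : nat := adj a b + adj a c + adj b c.

Definition pattern_size (p : bool * bool * bool) : nat := p.1.1 + p.1.2 + p.2.

Lemma sum_degrees_pattern : \sum_(x : G) \sum_(y : G) adj x y
  = 2 * (\sum_p pattern_size p * pattern_count p + hub_edges).
Proof.
have hub h : \sum_(y : G) adj h y = adj h a + adj h b + adj h c
               + \sum_(y | y \notin [:: a; b; c]) adj y h.
  rewrite sum_hubs; congr (_ + _).
  by apply: eq_bigr => y _; rewrite adj_sym.
have rest : \sum_(x | x \notin [:: a; b; c]) \sum_(y : G) adj x y
            = \sum_p pattern_size p * pattern_count p.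
  rewrite (eq_bigr (fun x => pattern_size (hub_pattern x))).
    by rewrite (sum_hub_pattern pattern_size); apply: eq_bigr => p _; rewrite -mulr_natr natn.
  move=> x xS; rewrite -[LHS](eq_bigr _ (fun y _ => erefl)).
  transitivity (\sum_(y | adj x y) 1).
    by rewrite [RHS]big_mkcond; apply: eq_bigr => y _; case: adj.
  by rewrite (sum_nbr (fun=> 1)) // /pattern_size /= !natn.
have back : \sum_(x | x \notin [:: a; b; c]) adj x a
            + \sum_(x | x \notin [:: a; b; c]) adj x b
            + \sum_(x | x \notin [:: a; b; c]) adj x c
            = \sum_p pattern_size p * pattern_count p.
  rewrite -!big_split (sum_hub_pattern pattern_size).
  by apply: eq_bigr => p _; rewrite -mulr_natr natn.
rewrite sum_hubs rest !hub -back !adj_irrefl (adj_sym b a) (adj_sym c a) (adj_sym c b).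
by rewrite /hub_edges; lia.
Qed.

(** Because the hubs form a cover, the other vertices are independent, and [independent_rayleigh]
    applies to weights supported on the hubs. *)
Lemma hub_rayleigh (R : realType) (t xa xb xc : R) :
  (0 < t -> spectral_radius R G <= t ->
  \sum_(p : bool * bool * bool)
     (p.1.1%:R * xa + p.1.2%:R * xb + p.2%:R * xc) ^+ 2 * (pattern_count p)%:R
    + t * (2 * ((adj a b)%:R * xa * xb + (adj a c)%:R * xa * xc
                + (adj b c)%:R * xb * xc))
    <= t ^+ 2 * (xa ^+ 2 + xb ^+ 2 + xc ^+ 2))%R.
Proof.
move=> t0 rt.
pose x u : R := if u == a then xa else if u == b then xb else
                if u == c then xc else 0%R.
have [xaE xbE xcE] : [/\ x a = xa, x b = xb & x c = xc].
  move: abc; rewrite /x /= !inE !negb_or andbT => /andP[/andP[ab ac] bc].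
  by rewrite !eqxx (eq_sym b a) (negPf ab) (eq_sym c a) (negPf ac) (eq_sym c b) (negPf bc).
have xS u : u \notin [:: a; b; c] -> x u = 0%R.
  by rewrite /x !inE !negb_or => /and3P[/negPf -> /negPf -> /negPf ->].
have indep : {in [set u | u \notin [:: a; b; c]] &, forall u v, ~~ adj u v}.
  move=> u v; rewrite !in_set => uS vS; apply: contra uS => /cover.
  by rewrite (negPf vS) orbF.
have xS0 : {in [set u | u \notin [:: a; b; c]], forall u, x u = 0%R}.
  by move=> u; rewrite in_set; exact: xS.
have := independent_rayleigh t0 rt indep xS0.
rewrite (eq_bigl (fun u => u \notin [:: a; b; c])) => [|u]; last by rewrite in_set.
rewrite (eq_bigr (fun u => ((hub_pattern u).1.1%:R * xa
    + (hub_pattern u).1.2%:R * xb + (hub_pattern u).2%:R * xc) ^+ 2))%R; last first.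
  move=> u uS; rewrite sum_nbr // xaE xbE xcE /=.
  by do 3![case: adj; rewrite ?mulr1n ?mulr0n ?mul1r ?mul0r].
rewrite (sum_hub_pattern
  (fun p : bool * bool * bool => (p.1.1%:R * xa + p.1.2%:R * xb + p.2%:R * xc) ^+ 2))%R.
have hub h : (\sum_(v | adj h v) x h * x v
   = x h * ((adj h a)%:R * xa + (adj h b)%:R * xb + (adj h c)%:R * xc))%R.
  rewrite -mulr_sumr big_mkcond sum_hubs big1 ?addr0.
    by rewrite xaE xbE xcE; do 3![case: adj; rewrite ?mul1r ?mul0r].
  by move=> y yS; rewrite xS // if_same.
have edges0 : (\sum_(u | u \notin [:: a; b; c]) \sum_(v | adj u v) x u * x v = 0)%R.
  by apply: big1 => u uS; apply: big1 => v _; rewrite xS // mul0r.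
have squares0 : (\sum_(u | u \notin [:: a; b; c]) x u ^+ 2 = 0)%R.
  by apply: big1 => u uS; rewrite xS // expr0n.
rewrite (sum_hubs (fun u => \sum_(v | adj u v) x u * x v)%R) edges0 !hub.
rewrite (sum_hubs (fun u => x u ^+ 2)%R) squares0 xaE xbE xcE !addr0.
rewrite !adj_irrefl (adj_sym b a) (adj_sym c a) (adj_sym c b).
apply: le_trans; rewrite le_eqVlt; apply/orP; left; apply/eqP.
rewrite /= mulr0n; congr (_ + _)%R; last by ring.
by apply: eq_bigr => p _; rewrite mulr_natr.
Qed.

End ThreeHubs.

(** * Isomorphism from equal pattern counts *)

Section HubColoring.
Variables (G : sgraph) (a b c : G).
Hypotheses (abc : uniq [:: a; b; c]) (nohub : hub_edges a b c = 0).
Hypothesis cover : forall x y, adj x y ->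
  (x \in [:: a; b; c]) || (y \in [:: a; b; c]).

(** The first triple tells which hub the vertex is, if any; the second lists its hub neighbours.
    With no edge between hubs, the classes are three singletons and the sets counted by
    [pattern_count]. *)
Definition hub_color (x : G) : (bool * bool * bool) * (bool * bool * bool) :=
  (x == a, x == b, x == c, hub_pattern a b c x).

Definition color_rel : rel ((bool * bool * bool) * (bool * bool * bool)) :=
  fun u v => [|| u.1.1.1 && v.2.1.1, u.1.1.2 && v.2.1.2, u.1.2 && v.2.2,
                 v.1.1.1 && u.2.1.1, v.1.1.2 && u.2.1.2 | v.1.2 && u.2.2].

Lemma hub_not_adj : {in [:: a; b; c] &, forall x y, adj x y = false}.
Proof.
have [ab ac bc] : [/\ adj a b = false, adj a c = false & adj b c = false].
  by move: nohub; rewrite /hub_edges; do 3!case: adj.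
move=> x y; rewrite !inE.
by do 2!case/or3P => /eqP ->; rewrite ?adj_irrefl // adj_sym.
Qed.

Lemma adj_hub_color (x y : G) : adj x y = color_rel (hub_color x) (hub_color y).
Proof.
rewrite /color_rel /=.
have hubE h z : h \in [:: a; b; c] ->
    adj z h = [|| (h == a) && adj z a, (h == b) && adj z b | (h == c) && adj z c].
  move=> hin; apply/idP/idP; last first.
    by case/or3P => /andP[/eqP ->].
  by move: hin; rewrite !inE => /or3P[]/eqP -> ->; rewrite eqxx ?orbT.
have notE z : z \notin [:: a; b; c] -> [/\ z == a = false, z == b = false & z == c = false].
  by rewrite !inE !negb_or => /and3P[/negPf -> /negPf -> /negPf ->].
have [xh|xh] := boolP (x \in [:: a; b; c]); have [yh|yh] := boolP (y \in [:: a; b; c]).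
- have [ah bh ch] : [/\ a \in [:: a; b; c], b \in [:: a; b; c] & c \in [:: a; b; c]].
    by rewrite !inE !eqxx !orbT.
  by rewrite !hub_not_adj // !andbF.
- have [-> -> ->] := notE y yh; rewrite !orbF /=.
  by rewrite adj_sym (hubE x y xh) !orbA.
- have [-> -> ->] := notE x xh; rewrite !orFb /=.
  by rewrite (hubE y x yh) !orbA.
- have [-> -> ->] := notE y yh; have [-> -> ->] := notE x xh.
  by apply/negbTE/negP => /cover; rewrite (negPf xh) (negPf yh).
Qed.

Lemma card_hub_color i : #|[set x | hub_color x == i]| =
  (((true, false, false, (false, false, false)) == i)
   + ((false, true, false, (false, false, false)) == i)
   + ((false, false, true, (false, false, false)) == i)
   + \sum_(p : bool * bool * bool)
       ((false, false, false, p) == i) * pattern_count a b c p).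
Proof.
rewrite -sum1_card big_mkcond (sum_hubs abc) /=.
have colE h : h \in [:: a; b; c] ->
    hub_color h = (h == a, h == b, h == c, (false, false, false)).
  move=> hh; have [ah bh ch] :
      [/\ a \in [:: a; b; c], b \in [:: a; b; c] & c \in [:: a; b; c]].
    by rewrite !inE !eqxx !orbT.
  by rewrite /hub_color /hub_pattern !hub_not_adj.
rewrite !in_set !colE ?inE ?eqxx ?orbT //.
have /andP[/norP[ab /norP[ac _]] /andP[/norP[bc _] _]] := abc.
rewrite (negPf ab) (negPf ac) (negPf bc) (eq_sym b a) (eq_sym c a) (eq_sym c b).
rewrite (negPf ab) (negPf ac) (negPf bc).
congr (_ + _ + _ + _); try by case: (_ == i).
rewrite (eq_bigr (fun x => nat_of_bool ((false, false, false, hub_pattern a b c x) == i))).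
  rewrite (sum_hub_pattern a b c (fun p => nat_of_bool ((false, false, false, p) == i))).
  by apply: eq_bigr => p _; rewrite -mulr_natr natn.
move=> x; rewrite !inE !negb_or => /and3P[/negPf xa /negPf xb /negPf xc].
by rewrite /hub_color xa xb xc; case: (_ == i).
Qed.

End HubColoring.

Lemma hub_graph_iso (G H : sgraph) (a b c : G) (a' b' c' : H) :
  uniq [:: a; b; c] -> uniq [:: a'; b'; c'] ->
  hub_edges a b c = 0 -> hub_edges a' b' c' = 0 ->
  (forall x y, adj x y -> (x \in [:: a; b; c]) || (y \in [:: a; b; c])) ->
  (forall x y, adj x y -> (x \in [:: a'; b'; c']) || (y \in [:: a'; b'; c'])) ->
  pattern_count a b c =1 pattern_count a' b' c' ->
  graph_iso G H.
Proof.
move=> u u' k k' cov cov' NE.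
apply: (@coloring_graph_iso _ _ _ color_rel (hub_color a b c) (hub_color a' b' c') a').
- exact: adj_hub_color.
- exact: adj_hub_color.
- move=> i; rewrite !card_hub_color //; congr (_ + _).
  by apply: eq_bigr => p _; rewrite NE.
Qed.

(* 120 (t^2 - n / 3) for the threshold t of the header. *)
Definition threshold_shift (n : nat) : nat := nth 0 [:: 240; 248; 247] (n %% 3).

Lemma threshold_shift_bounds n : 240 <= threshold_shift n <= 248.
Proof.
rewrite /threshold_shift; move: (ltn_pmod n (isT : 0 < 3)).
by case: (n %% 3) => [|[|[|]]].
Qed.

(** * Counts forced by the Rayleigh bound *)

Section HubCounts.
Variables (R : realType) (G : sgraph) (a b c : G) (t : R).
Hypotheses (abc : uniq [:: a; b; c]) (G12 : 12 <= #|G|).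
Hypothesis cover : forall x y, adj x y ->
  (x \in [:: a; b; c]) || (y \in [:: a; b; c]).
Hypothesis edges_ge : 2 * #|G| <= \sum_(x : G) \sum_(y : G) adj x y.
Hypothesis t0 : (0 < t)%R.
Hypothesis t2 : (120 * t ^+ 2 = (40 * #|G| + threshold_shift #|G|)%:R)%R.
Hypothesis rt : (spectral_radius R G <= t)%R.

Local Notation N := (pattern_count a b c).

(** Write n for [#|G|], k for [hub_edges a b c], and D for the sum of |P|^2 N_P. Weights (1, 1, 1)
    give D + 2tk <= 3t^2 <= n + 31/5. Since |P|^2 >= 3|P| - 2, with equality only for |P| = 1 or 2,
    having at least n edges forces D >= n + 6 - 3k. As 2t >= 24/5, this leaves k = 0; then D = n + 6
    by integrality, and equality throughout fixes the sums. *)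
Lemma hub_counts :
  [/\ hub_edges a b c = 0, N (true, true, true) = 0, N (false, false, false) = 0,
      N (true, true, false) + N (true, false, true) + N (false, true, true) = 3
    & N (true, false, false) + N (false, true, false) + N (false, false, true) + 6
      = #|G|].
Proof.
have shift := threshold_shift_bounds #|G|.
have [cardE edges_le] : #|G| = 3 + (N (true, true, true) + N (true, true, false)
      + (N (true, false, true) + N (true, false, false))
      + (N (false, true, true) + N (false, true, false)
         + (N (false, false, true) + N (false, false, false))))
    /\ #|G| <= 3 * N (true, true, true) + 2 * N (true, true, false)
      + (2 * N (true, false, true) + 1 * N (true, false, false))
      + (2 * N (false, true, true) + 1 * N (false, true, false)
         + (1 * N (false, false, true) + 0 * N (false, false, false)))
      + hub_edges a b c.
  split; first by rewrite (card_pattern_count abc) big_pattern.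
  have := edges_ge; rewrite (sum_degrees_pattern abc cover) leq_mul2l /=.
  by rewrite big_pattern.
have ray : ((9 * N (true, true, true) + 4 * N (true, true, false)
      + 4 * N (true, false, true) + N (true, false, false)
      + 4 * N (false, true, true) + N (false, true, false)
      + N (false, false, true))%:R + 2 * (t * (hub_edges a b c)%:R) <= 3 * t ^+ 2)%R.
  have := hub_rayleigh abc cover 1 1 1 t0 rt; rewrite big_pattern /=.
  have -> : ((adj a b)%:R * 1 * 1 + (adj a c)%:R * 1 * 1 + (adj b c)%:R * 1 * 1
             = (hub_edges a b c)%:R :> R)%R.
    by rewrite /hub_edges !natrD !mulr1.
  by rewrite !natrD ?natrM; lra.
move: ray cardE edges_le.
move: (N (true, true, true)) (N (true, true, false)) (N (true, false, true)).
move: (N (true, false, false)) (N (false, true, true)) (N (false, true, false)).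
move: (N (false, false, true)) (N (false, false, false)) (hub_edges a b c).
move=> n3 n0 k n1 n23 n2 n123 n12 n13 ray cardE edges_le.
move: (threshold_shift #|G|) shift t2 => s shift t2s.
have t2E : ((40 * #|G| + s)%:R
            = 40 * #|G|%:R + (s)%:R :> R)%R.
  by rewrite natrD natrM.
have t_ge : (12 / 5 <= t)%R.
  have G12r : (12%:R <= #|G|%:R :> R)%R by rewrite ler_nat.
  have sr : (240%:R <= s%:R :> R)%R by rewrite ler_nat; lia.
  by move: t2s; rewrite t2E; have := t0; nra.
have t2le : (120 * t ^+ 2 <= 40 * #|G|%:R + 248)%R.
  by rewrite t2s t2E lerD2l ler_nat; lia.
set D := (9 * n123 + _ + _ + _ + _ + _ + _) in ray *.
have k0 : k = 0.
  apply/eqP; rewrite -leqn0 leqNgt; apply/negP => k_gt0.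
  have k1 : (1 <= k%:R :> R)%R by rewrite (ler_nat R 1 k).
  have GD : (#|G|%:R + 6 <= D%:R + 3 * k%:R :> R)%R.
    by rewrite -natrM -!natrD ler_nat /D; lia.
  have tk : (0 <= (t - 12 / 5) * k%:R)%R by apply: mulr_ge0; lra.
  by move: ray; lra.
have le6 : D <= #|G| + 6.
  rewrite -ltnS -(ltr_nat R) (_ : (#|G| + 6).+1 = #|G| + 7)%N; last by lia.
  by rewrite natrD; move: ray; rewrite k0; lra.
by move: k0 le6; rewrite /D => k0 le6; split; lia.
Qed.

(** Natural weights and the factor 120 turn the Rayleigh bound into an inequality of natural numbers
    that is linear in the counts, within the scope of [lia]. *)
Lemma hub_test_vector (x y z : nat) : hub_edges a b c = 0 ->
  120 * (N (true, true, true) * (x + y + z) ^ 2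
    + N (true, true, false) * (x + y) ^ 2 + N (true, false, true) * (x + z) ^ 2
    + N (false, true, true) * (y + z) ^ 2 + N (true, false, false) * x ^ 2
    + N (false, true, false) * y ^ 2 + N (false, false, true) * z ^ 2)
  <= (40 * #|G| + threshold_shift #|G|) * (x ^ 2 + y ^ 2 + z ^ 2).
Proof.
move=> k0; have [ab ac bc] : [/\ adj a b = false, adj a c = false & adj b c = false].
  by move: k0; rewrite /hub_edges; do 3!case: adj.
have := hub_rayleigh abc cover x%:R y%:R z%:R t0 rt; rewrite big_pattern /=.
rewrite ab ac bc -(ler_nat R) !mulr0n => ray.
by rewrite 2!natrM -t2 !natrD !natrM ?natrX ?natrD; lra.
Qed.

End HubCounts.

(** Permuting three points permutes their three pairs in all possible ways. Applied to [codegree],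
    it removes the freedom in labelling the hubs. *)
Lemma sort_three (T : eqType) (f : T -> T -> nat) (a b c : T) :
  (forall x y, f x y = f y x) ->
  exists a' b' c', perm_eq [:: a'; b'; c'] [:: a; b; c] /\
    f b' c' <= f a' b' <= f a' c'.
Proof.
move=> fC.
have pr x y z : perm_eq [:: x; y; z] [:: a; b; c] ->
    f y z <= f x y -> f x y <= f x z ->
    exists a' b' c', perm_eq [:: a'; b'; c'] [:: a; b; c] /\
      f b' c' <= f a' b' <= f a' c'.
  by move=> ? ? ?; exists x, y, z; split=> //; apply/andP.
have rot3 (x y z : T) : perm_eq [:: x; y; z] [:: y; z; x].
  by rewrite -(perm_rcons x [:: y; z]).
have swap (x y z : T) : perm_eq [:: x; y; z] [:: x; z; y].
  by rewrite perm_cons (perm_catC [:: y] [:: z]).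
have p1 : perm_eq [:: a; b; c] [:: a; b; c] by [].
have p2 := swap a c b.
have p3 : perm_eq [:: c; a; b] [:: a; b; c] := rot3 c a b.
have p4 : perm_eq [:: b; c; a] [:: a; b; c] := perm_trans (rot3 b c a) p3.
have p5 : perm_eq [:: c; b; a] [:: a; b; c] := perm_trans (swap c b a) p3.
have p6 : perm_eq [:: b; a; c] [:: a; b; c] := perm_trans (swap b a c) p4.
have [ba [ca cb]] := (fC b a, (fC c a, fC c b)).
have [h1|h1] := leqP (f a b) (f a c); have [h2|h2] := leqP (f a b) (f b c);
  have [h3|h3] := leqP (f a c) (f b c);
  solve [ by apply: (pr _ _ _ p1); lia | by apply: (pr _ _ _ p2); lia
        | by apply: (pr _ _ _ p3); lia | by apply: (pr _ _ _ p4); lia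
        | by apply: (pr _ _ _ p5); lia | by apply: (pr _ _ _ p6); lia ].
Qed.

Section HubProfile.
Variables (G : sgraph) (a b c : G).
Local Notation N := (pattern_count a b c).

Definition codegree (x y : G) : nat := \sum_(z : G) (adj z x && adj z y).

Definition hub_profile (n1 n2 n3 n12 n13 n23 : nat) : Prop :=
  hub_edges a b c = 0 /\
  forall p, N p = match p with
    | (true, false, false) => n1 | (false, true, false) => n2
    | (false, false, true) => n3 | (true, true, false) => n12
    | (true, false, true) => n13 | (false, true, true) => n23
    | _ => 0 end.

Lemma codegree_pattern : uniq [:: a; b; c] -> hub_edges a b c = 0 ->
  [/\ codegree a b = N (true, true, true) + N (true, true, false),
      codegree a c = N (true, true, true) + N (true, false, true) &
      codegree b c = N (true, true, true) + N (false, true, true)].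
Proof.
move=> abc k0; have [ab ac bc] : [/\ adj a b = false, adj a c = false & adj b c = false].
  by move: k0; rewrite /hub_edges; do 3!case: adj.
split; rewrite /codegree (sum_hubs abc) !adj_irrefl ?(adj_sym b a) ?(adj_sym c a)
  ?(adj_sym c b) ab ac bc ?andbF /=.
- rewrite (sum_hub_pattern a b c (fun p => nat_of_bool (p.1.1 && p.1.2))).
  by rewrite big_pattern /= ?mul0rn ?natn ?addr0 ?add0r.
- rewrite (sum_hub_pattern a b c (fun p => nat_of_bool (p.1.1 && p.2))).
  by rewrite big_pattern /= ?mul0rn ?natn ?addr0 ?add0r.
- rewrite (sum_hub_pattern a b c (fun p => nat_of_bool (p.1.2 && p.2))).
  by rewrite big_pattern /= ?mul0rn ?natn ?addr0 ?add0r.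
Qed.

(** The closed neighbourhood of [b] misses [a], so an edge leaves it; this edge joins an outer
    neighbour of [b] to another hub. *)
Lemma hub_linked : uniq [:: a; b; c] -> connected_graph G ->
  (forall x y, adj x y -> (x \in [:: a; b; c]) || (y \in [:: a; b; c])) ->
  hub_edges a b c = 0 -> N (true, true, true) = 0 ->
  0 < N (true, true, false) + N (false, true, true).
Proof.
move=> abc conn cov k0 n123; rewrite lt0n addn_eq0; apply/negP => /andP[/eqP n12 /eqP n23].
have none x p : x \notin [:: a; b; c] -> hub_pattern a b c x = p -> N p <> 0.
  move=> xS xp /eqP; rewrite cards_eq0 => /eqP N0.
  by have := in_set0 x; rewrite -N0 in_set xS xp eqxx.
have nhub := hub_not_adj k0.
have [ah bh ch] : [/\ a \in [:: a; b; c], b \in [:: a; b; c] & c \in [:: a; b; c]].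
  by rewrite !inE !eqxx !orbT.
have /andP[/norP[ab _] _] := abc.
have aW : a \notin b |: [set x | adj x b] by rewrite !inE (negPf ab) nhub.
have [u [v [uW vW uv]]] := connected_boundary conn (setU11 b _) aW.
have ub : adj u b.
  move: uW vW; rewrite !inE => /orP[/eqP uE|//].
  by rewrite uE in uv; rewrite adj_sym uv orbT.
have uS : u \notin [:: a; b; c] by apply: contraTN ub => uh; rewrite nhub.
have vh : v \in [:: a; b; c] by have := cov u v uv; rewrite (negPf uS).
have uP := none u _ uS (erefl _).
move: vh vW uP; rewrite !inE /hub_pattern ub => /or3P[]/eqP vE; rewrite vE ?eqxx //.
- by rewrite vE in uv; rewrite uv; case: (adj u c).
- by rewrite vE in uv; rewrite uv; case: (adj u a).
Qed.

End HubProfile.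

Lemma profile_graph_iso (G H : sgraph) (a b c : G) (a' b' c' : H) n1 n2 n3 n12 n13 n23 :
  uniq [:: a; b; c] -> uniq [:: a'; b'; c'] ->
  (forall x y, adj x y -> (x \in [:: a; b; c]) || (y \in [:: a; b; c])) ->
  (forall x y, adj x y -> (x \in [:: a'; b'; c']) || (y \in [:: a'; b'; c'])) ->
  hub_profile a b c n1 n2 n3 n12 n13 n23 ->
  hub_profile a' b' c' n1 n2 n3 n12 n13 n23 -> graph_iso G H.
Proof.
move=> u u' cov cov' [k0 NE] [k0' NE'].
by apply: (hub_graph_iso u u') => // p; rewrite NE NE'.
Qed.

(** In the profiles ending in [1 2 0] the hubs [a'], [b'], [c'] play the roles of v3, v1, v5 of
    [G2]: [a'] shares one neighbour with [b'] and two with [c']. *)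
Lemma three_cover_profile (R : realType) (G : sgraph) (a b c : G) (t : R) :
  uniq [:: a; b; c] ->
  (forall x y, adj x y -> (x \in [:: a; b; c]) || (y \in [:: a; b; c])) ->
  12 <= #|G| -> unicyclic G -> (0 < t)%R ->
  (120 * t ^+ 2 = (40 * #|G| + threshold_shift #|G|)%:R)%R ->
  (spectral_radius R G <= t)%R ->
  let m := #|G| %/ 3 in
  exists a' b' c' : G, [/\ uniq [:: a'; b'; c'],
    forall x y, adj x y -> (x \in [:: a'; b'; c']) || (y \in [:: a'; b'; c']) &
    match #|G| %% 3 with
    | 0 => hub_profile a' b' c' (m - 4) m (m - 2) 1 2 0 \/
           hub_profile a' b' c' (m - 2) (m - 2) (m - 2) 1 1 1
    | 1 => hub_profile a' b' c' (m - 3) m (m - 2) 1 2 0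
    | _ => hub_profile a' b' c' (m - 4) (m + 1) (m - 1) 1 2 0
    end].
Proof.
move=> u cov G12 uc t0 t2 rt m.
have E := unicyclic_sum_degrees uc.
have [|a' [b' [c' [p sorted_]]]] := sort_three (f := @codegree G) a b c.
  by move=> x y; apply: eq_bigr => z _; rewrite andbC.
have u' : uniq [:: a'; b'; c'] by rewrite (perm_uniq p).
have cov' x y : adj x y -> (x \in [:: a'; b'; c']) || (y \in [:: a'; b'; c']).
  by rewrite !(perm_mem p); exact: cov.
exists a', b', c'; split => //.
have [k0' n123 n0 pairs tot] := hub_counts u' G12 cov' E t0 t2 rt.
have [c12 c13 c23] := codegree_pattern u' k0'.
have link := hub_linked u' uc.1 cov' k0' n123.
have vec x y z := hub_test_vector u' cov' t0 t2 rt x y z k0'.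
move: sorted_; rewrite c12 c13 c23 n123 !add0n => sorted_.
have prof n1 n2 n3 n12 n13 n23 :
    pattern_count a' b' c' (true, false, false) = n1 ->
    pattern_count a' b' c' (false, true, false) = n2 ->
    pattern_count a' b' c' (false, false, true) = n3 ->
    pattern_count a' b' c' (true, true, false) = n12 ->
    pattern_count a' b' c' (true, false, true) = n13 ->
    pattern_count a' b' c' (false, true, true) = n23 ->
    hub_profile a' b' c' n1 n2 n3 n12 n13 n23.
  by move=> ? ? ? ? ? ?; split=> // -[[[] []] []].
move: vec; rewrite n123 /threshold_shift.
have m4 : 4 <= m by rewrite /m; lia.
have GE : #|G| = 3 * m + #|G| %% 3 by rewrite /m; lia.
have := ltn_pmod #|G| (isT : 0 < 3).
move: prof pairs tot link sorted_ GE.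
move: (pattern_count _ _ _ (true, false, false)) (pattern_count _ _ _ (false, true, false))
  (pattern_count _ _ _ (false, false, true)) (pattern_count _ _ _ (true, true, false))
  (pattern_count _ _ _ (true, false, true)) (pattern_count _ _ _ (false, true, true)).
move=> n1 n2 n3 n12 n13 n23 prof pairs tot link sorted_.
(* Three shared neighbours in sorted order are 3+0+0, excluded by [link], or 2+1+0 as in [G2], or
   1+1+1 as in [G3]. *)
have types : (n12 = 1 /\ n13 = 2 /\ n23 = 0) \/ (n12 = 1 /\ n13 = 1 /\ n23 = 1) by lia.
move: m4 tot; move: #|G| (#|G| %% 3) m => n r m m4 tot nE r3; rewrite nE in tot *; clear n nE.
(* The test vectors are integer approximations of the top eigenvectors of the
   competing counts. *)
case: r r3 tot => [|[|[|]]] // _ tot /= vec; case: types => -[? [? ?]]; subst n12 n13 n23.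
- by left; apply: prof => //;
    move: (vec 2 1 2) (vec 1 2 1) (vec 2 2 1) (vec 1 1 2); rewrite -!mulnn; lia.
- by right; apply: prof => //;
    move: (vec 1 1 2) (vec 2 2 1) (vec 1 2 1) (vec 2 1 1); rewrite -!mulnn; lia.
- by apply: prof => //;
    move: (vec 2 2 3) (vec 2 2 1) (vec 1 0 1) (vec 1 2 1); rewrite -!mulnn; lia.
(* The weights 2, 2, 3 in each order force every single count to be at most m - 2, but they sum to
   3m - 5. *)
- by move: (vec 2 2 3) (vec 2 2 1) (vec 2 3 2) (vec 3 2 2); rewrite -!mulnn; lia.
- by apply: prof => //;
    move: (vec 2 1 2) (vec 0 1 0) (vec 3 3 2) (vec 1 0 2); rewrite -!mulnn; lia.
(* The weights 3, 3, 2 in each order force every single count to be at least m - 1, but they sum to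
   3m - 4. *)
- by move: (vec 1 1 2) (vec 3 3 2) (vec 2 3 3) (vec 3 2 3); rewrite -!mulnn; lia.
Qed.

(** * The extremal graphs *)

Section Pendants.
Variables (G : sgraph) (m : G -> nat).
Local Notation GP := (attach_pendant m).

Lemma sum_attach_pendant (V : nmodType) (F : GP -> V) :
  (\sum_x F x = \sum_(v : G) F (inl v)
     + \sum_(v : G) \sum_(i < m v) F (inr (Tagged (fun v => 'I_(m v)) i)))%R.
Proof.
rewrite big_sumType /=; congr (_ + _)%R.
rewrite (sig_big_dep (fun=> true) (fun=> xpredT)
  (fun v (i : 'I_(m v)) => F (inr (Tagged (fun v => 'I_(m v)) i)))) /=.
by apply: eq_bigr => -[].
Qed.

Lemma card_attach_pendant : #|GP| = #|G| + \sum_(v : G) m v.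
Proof.
rewrite card_sum card_tagged; congr (_ + _).
by rewrite sumnE big_map big_enum /=; apply: eq_bigr => v _; rewrite card_ord.
Qed.

Lemma pattern_count_attach_pendant (a b c : G) p :
  @pattern_count GP (inl a) (inl b) (inl c) p
  = \sum_(v : G) (((v \notin [:: a; b; c]) && (hub_pattern a b c v == p))
                  + m v * ((v == a, v == b, v == c) == p)).
Proof.
rewrite /pattern_count -sum1_card big_mkcond sum_attach_pendant big_split /=.
congr (_ + _); apply: eq_bigr => v _.
  by rewrite in_set !inE /hub_pattern /=; case: (_ && _).
rewrite (eq_bigr (fun=> nat_of_bool ((v == a, v == b, v == c) == p))).
  by rewrite sum_nat_const card_ord.
move=> i _; rewrite in_set !inE /hub_pattern /= !(eq_sym v).
by case: (_ == p).
Qed.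

Lemma attach_pendant_cover (a b c : G) :
  (forall u v : G, adj u v -> (u \in [:: a; b; c]) || (v \in [:: a; b; c])) ->
  (forall v, 0 < m v -> v \in [:: a; b; c]) ->
  forall x y : GP, adj x y ->
    (x \in [:: inl a; inl b; inl c]) || (y \in [:: inl a; inl b; inl c]).
Proof.
move=> cov sup; have inlE (v : G) :
    (inl v \in [:: inl a : GP; inl b; inl c]) = (v \in [:: a; b; c]).
  by rewrite !inE.
move=> [u|[u i]] [v|[v j]] //=; rewrite ?inlE.
- exact: cov.
- by move=> /eqP ->; rewrite sup //; case: j => j; apply: leq_ltn_trans.
- by move=> /eqP ->; rewrite sup ?orbT //; case: i => j; apply: leq_ltn_trans.
Qed.

Lemma attach_pendant_connected : connected_graph G -> connected_graph GP.
Proof.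
move=> [G0 conn]; split; first by rewrite card_attach_pendant ltn_addr.
have symP : connect_sym (@adj GP) by apply/sym_connect_sym/adj_sym.
have core u v : connect (@adj GP) (inl u) (inl v).
  have /connectP[s us ->] := conn u v; elim: s u us => [|w s IH] u /=.
    by rewrite connect0.
  by case/andP=> uw /IH; apply: connect_trans; apply: connect1.
have root x : exists u, connect (@adj GP) x (inl u).
  case: x => [u|[u i]]; exists u; first exact: connect0.
  by apply: connect1; rewrite /= eqxx.
move=> x y; have [u xu] := root x; have [v yv] := root y.
by apply: connect_trans xu (connect_trans (core u v) _); rewrite symP.
Qed.

End Pendants.

Section Targets.
Variables p q r : nat.

Local Notation v1 := (inl (@Ordinal 6 0 isT)).
Local Notation v3 := (inl (@Ordinal 6 2 isT)).
Local Notation v5 := (inl (@Ordinal 6 4 isT)).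

Lemma sum_I6 (F : 'I_6 -> nat) :
  \sum_i F i = F (@Ordinal 6 0 isT) + (F (@Ordinal 6 1 isT)
    + (F (@Ordinal 6 2 isT) + (F (@Ordinal 6 3 isT)
    + (F (@Ordinal 6 4 isT) + F (@Ordinal 6 5 isT))))).
Proof.
by rewrite !big_ord_recl big_ord0 addn0;
  do 5?[congr (_ + _)]; congr F; apply: val_inj.
Qed.

(** Evaluates the closed conditions on the six core vertices while [p], [q], [r] stay symbolic. *)
Ltac compute_bools := repeat match goal with |- context [nat_of_bool ?b] =>
  progress (let v := eval vm_compute in b in change b with v) end.

(** The order v3, v1, v5 matches the sorted codegrees: v2 is the common neighbour of v1 and v3,
    while v4 and v6 are those of v3 and v5. *)
Lemma G2_profile : @hub_profile (G2 p q r) v3 v1 v5 q p r 1 2 0.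
Proof.
split=> [|s]; first by vm_compute.
rewrite pattern_count_attach_pendant sum_I6.
by case: s => -[[] []] []; compute_bools; rewrite /at_v135 /=; lia.
Qed.

Lemma G3_profile : @hub_profile (G3 p q r) v1 v3 v5 p q r 1 1 1.
Proof.
split=> [|s]; first by vm_compute.
rewrite pattern_count_attach_pendant sum_I6.
by case: s => -[[] []] []; compute_bools; rewrite /at_v135 /=; lia.
Qed.

Lemma G2_card : #|G2 p q r| = p + q + r + 6.
Proof. by rewrite card_attach_pendant sum_I6 card_ord /at_v135 /=; lia. Qed.

Lemma at_v135_support (v : 'I_6) : 0 < at_v135 p q r v ->
  v \in [:: @Ordinal 6 0 isT; @Ordinal 6 2 isT; @Ordinal 6 4 isT].
Proof. by case: v => -[|[|[|[|[|[|?]]]]]] ?. Qed.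

Lemma G2_cover (x y : G2 p q r) : adj x y ->
  (x \in [:: v3; v1; v5]) || (y \in [:: v3; v1; v5]).
Proof.
move: x y; apply: attach_pendant_cover => [u v|v].
  move: u v => [[|[|[|[|[|[|?]]]]]] ?] // [[|[|[|[|[|[|?]]]]]] ?] //.
by move/at_v135_support; rewrite !inE => /or3P[]->; rewrite ?orbT.
Qed.

Lemma G3_cover (x y : G3 p q r) : adj x y ->
  (x \in [:: v1; v3; v5]) || (y \in [:: v1; v3; v5]).
Proof.
move: x y; apply: attach_pendant_cover => [u v|v].
  move: u v => [[|[|[|[|[|[|?]]]]]] ?] // [[|[|[|[|[|[|?]]]]]] ?] //.
exact: at_v135_support.
Qed.

End Targets.

Lemma cycle_two_neighbors (G : sgraph) (d : seq G) (x : G) :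
  is_cycle d -> x \in d -> exists y z,
    [/\ y != z, y \in d, z \in d & [/\ adj x y, adj x z,
        [set x; y] \in cycle_edges d & [set x; z] \in cycle_edges d]].
Proof.
move=> cyc xd; have /andP[_ /andP[cd ud]] := cyc.
exists (next d x), (prev d x).
rewrite mem_next mem_prev xd next_cycle // adj_sym prev_cycle //; split=> //.
  apply/eqP => E; have := next_next_neq cyc xd.
  by rewrite E next_prev // eqxx.
split=> //; first exact: imset_f.
have -> : [set x; prev d x] = [set prev d x; next d (prev d x)].
  by rewrite next_prev // setUC.
by apply: imset_f; rewrite mem_prev.
Qed.

(** * Membership of [G2] in the class *)

Section G2Class.
Variables p q r : nat.
Local Notation G := (G2 p q r).

Let v1 : G := inl (@Ordinal 6 0 isT).
Let v2 : G := inl (@Ordinal 6 1 isT).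
Let v3 : G := inl (@Ordinal 6 2 isT).
Let v4 : G := inl (@Ordinal 6 3 isT).
Let v5 : G := inl (@Ordinal 6 4 isT).
Let v6 : G := inl (@Ordinal 6 5 isT).

Lemma P6_chord_connected : connected_graph P6_chord.
Proof.
split; first by rewrite card_ord.
have symP : connect_sym (@adj P6_chord) by apply/sym_connect_sym/adj_sym.
pose w i : P6_chord := inord i.
have step i : i < 5 -> connect (@adj P6_chord) (w i) (w i.+1).
  move=> i5; apply: connect1; move: i i5.
  by do 5![case=> [_|] /=; first by rewrite /edge_list_adj /w -val_eqE /= !inordK].
have root i : i < 6 -> connect (@adj P6_chord) (w 0) (w i).
  elim: i => [|i IH] i6; first exact: connect0.
  by apply: connect_trans (IH (ltnW i6)) (step _ _).
move=> x y; have wE (z : P6_chord) : z = w z by rewrite /w inord_val.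
rewrite (wE x) (wE y); apply: connect_trans (root _ (ltn_ord y)).
by rewrite symP root.
Qed.

Lemma G2_matching_number : matching_number G = 3.
Proof.
apply/eqP; rewrite eqn_leq; apply/andP; split.
  apply: leq_trans (matching_number_le_cover (C := [set v3; v1; v5]) _) _.
    by move=> x y /G2_cover; rewrite !inE -!orbA.
  by rewrite setUC cardsU1 cards2; case: (_ \notin _); case: (_ != _).
by apply: (@size_le_matching_number _ [:: (v1, v2); (v3, v4); (v5, v6)]).
Qed.

Definition square_edges : {set {set G}} :=
  [set [set v3; v4]; [set v4; v5]; [set v5; v6]; [set v3; v6]].

(** Every vertex of a cycle has two neighbours on it. This discards the pendant vertices, then v1,
    then v2; on the remaining square each vertex forces both of its edges and both of its
    neighbours. *)
Lemma G2_cycle_edges (d : seq G) : is_cycle d -> cycle_edges d = square_edges.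
Proof.
move=> cyc.
have leaf i : inr i \notin d.
  apply/negP => id; have [y [z [yz _ _ [iy iz _ _]]]] := cycle_two_neighbors cyc id.
  case: y z yz iy iz => [y|y] [z|z] //= yz /eqP yE /eqP zE.
  by rewrite yE zE eqxx in yz.
have n1 : v1 \notin d.
  apply/negP => id; have [y [z [yz yd zd [iy iz _ _]]]] := cycle_two_neighbors cyc id.
  case: y yz yd iy => [y|y]; last by rewrite (negPf (leaf y)).
  case: z zd iz => [z|z]; last by rewrite (negPf (leaf z)).
  case: y z => [[|[|[|[|[|[|?]]]]]] ?] // [[|[|[|[|[|[|?]]]]]] ?] //.
have n2 : v2 \notin d.
  apply/negP => id; have [y [z [yz yd zd [iy iz _ _]]]] := cycle_two_neighbors cyc id.
  have n1' l : inl (@Ordinal 6 0 l) \notin d by rewrite (bool_irrelevance l isT).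
  case: y yz yd iy => [y|y]; last by rewrite (negPf (leaf y)).
  case: z zd iz => [z|z]; last by rewrite (negPf (leaf z)).
  by case: y z => [[|[|[|[|[|[|?]]]]]] ?] // [[|[|[|[|[|[|?]]]]]] ?] //;
    rewrite ?(negPf (n1' _)).
have core x : x \in d -> [\/ x = v3, x = v4, x = v5 | x = v6].
  case: x => [[[|[|[|[|[|[|i]]]]]] l]|i]; last by rewrite (negPf (leaf i)).
  - by rewrite (bool_irrelevance l isT) -/v1 (negPf n1).
  - by rewrite (bool_irrelevance l isT) -/v2 (negPf n2).
  - by rewrite (bool_irrelevance l isT); constructor 1.
  - by rewrite (bool_irrelevance l isT); constructor 2.
  - by rewrite (bool_irrelevance l isT); constructor 3.
  - by rewrite (bool_irrelevance l isT); constructor 4.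
  - by [].
pose D := cycle_edges d.
have s3 : v3 \in d -> [/\ v4 \in d, v6 \in d, [set v3; v4] \in D & [set v3; v6] \in D].
  move=> xd; have [y [z [yz yd zd [iy iz ey ez]]]] := cycle_two_neighbors cyc xd.
  by case: (core y yd) => E; subst y => //; case: (core z zd) => E; subst z.
have s4 : v4 \in d -> [/\ v3 \in d, v5 \in d, [set v3; v4] \in D & [set v4; v5] \in D].
  move=> xd; have [y [z [yz yd zd [iy iz ey ez]]]] := cycle_two_neighbors cyc xd.
  by rewrite [[set v3; v4]]setUC;
    case: (core y yd) => E; subst y => //; case: (core z zd) => E; subst z.
have s5 : v5 \in d -> [/\ v4 \in d, v6 \in d, [set v4; v5] \in D & [set v5; v6] \in D].
  move=> xd; have [y [z [yz yd zd [iy iz ey ez]]]] := cycle_two_neighbors cyc xd.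
  by rewrite [[set v4; v5]]setUC;
    case: (core y yd) => E; subst y => //; case: (core z zd) => E; subst z.
have s6 : v6 \in d -> [/\ v3 \in d, v5 \in d, [set v3; v6] \in D & [set v5; v6] \in D].
  move=> xd; have [y [z [yz yd zd [iy iz ey ez]]]] := cycle_two_neighbors cyc xd.
  by rewrite [[set v3; v6]]setUC [[set v5; v6]]setUC;
    case: (core y yd) => E; subst y => //; case: (core z zd) => E; subst z.
have d3 : v3 \in d.
  have /andP[sd _] := cyc.
  have [x xd] : exists x, x \in d by case: (d) sd => // x ? _; exists x; exact: mem_head.
  case: (core x xd) => E; rewrite E in xd => //; first by case: (s4 xd).
    by case: (s5 xd) => /s4[].
  by case: (s6 xd).
have [d4 d6 e34 e36] := s3 d3; have [_ d5 _ e45] := s4 d4; have [_ _ _ e56] := s5 d5.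
apply/eqP; rewrite eqEsubset; apply/andP; split; apply/subsetP => e; last first.
  by rewrite !inE -!orbA => /or4P[]/eqP ->.
case/imsetP => x xd ->; have /andP[_ /andP[cd _]] := cyc.
have := next_cycle cd xd; have := mem_next d x; rewrite xd => /core.
have sq a b : [set a; b] \in square_edges -> [set b; a] \in square_edges.
  by rewrite setUC.
have [m34 m45 m56 m36] : [/\ [set v3; v4] \in square_edges,
    [set v4; v5] \in square_edges, [set v5; v6] \in square_edges
  & [set v3; v6] \in square_edges] by rewrite !inE !eqxx !orbT.
case=> ->; case: (core x xd) => -> //= _;
  solve [ exact: m34 | exact: m45 | exact: m56 | exact: m36
        | exact: sq m34 | exact: sq m45 | exact: sq m56 | exact: sq m36 ].
Qed.

Lemma G2_unicyclic : unicyclic G.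
Proof.
split; first exact/attach_pendant_connected/P6_chord_connected.
by exists [:: v3; v4; v5; v6] => // d cd; rewrite !G2_cycle_edges.
Qed.

Lemma G2_class : unicyclic_class (p + q + r + 6) 3 G.
Proof. by split; [exact: G2_unicyclic|exact: G2_card|exact: G2_matching_number]. Qed.

End G2Class.

Section PendantNeighbors.
Local Open Scope ring_scope.
Variables (R : pzRingType) (G : sgraph) (m : G -> nat).
Local Notation GP := (attach_pendant m).
Variables f g : G -> R.

Definition pendant_vector (x : GP) : R :=
  match x with inl u => f u | inr i => g (tag i) end.

Lemma sum_nbr_pendant_vector (u : G) :
  \sum_(y : GP | adj (inl u : GP) y) pendant_vector y
  = \sum_(v | adj u v) f v + (m u)%:R * g u.
Proof.
rewrite big_mkcond sum_attach_pendant -big_mkcond /=; congr (_ + _).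
rewrite (bigD1 u) //= [X in _ + X]big1 ?addr0 => [|v vu].
  under eq_bigr do rewrite eqxx.
  by rewrite sumr_const card_ord mulr_natl.
by apply: big1 => i _; rewrite eq_sym (negPf vu).
Qed.

Lemma sum_nbr_pendant_leaf (i : {v : G & 'I_(m v)}) :
  \sum_(y : GP | adj (inr i : GP) y) pendant_vector y = f (tag i).
Proof.
rewrite big_mkcond sum_attach_pendant /= [X in _ + X]big1 ?addr0.
  by rewrite -big_mkcond (big_pred1 (tag i)).
by move=> v _; apply: big1.
Qed.

End PendantNeighbors.

Section G2Upper.
Local Open Scope ring_scope.
Variables (R : realType) (p q r : nat) (t x1 x3 x5 : R).

(** The last three hypotheses say that the reduced 3 by 3 matrix sends (x1, x3, x5) below [t ^+ 2]
    times itself. Giving every other vertex the sum over its hub neighbours divided by [t] makes its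
    own inequality an equality. *)
Lemma G2_spectral_radius_le :
  0 < t -> 0 < x1 -> 0 < x3 -> 0 < x5 ->
  (p%:R + 1) * x1 + x3 <= t ^+ 2 * x1 ->
  (q%:R + 3) * x3 + x1 + 2 * x5 <= t ^+ 2 * x3 ->
  (r%:R + 2) * x5 + 2 * x3 <= t ^+ 2 * x5 ->
  spectral_radius R (G2 p q r) <= t.
Proof.
move=> t0 p1 p3 p5 h1 h3 h5.
(* The default branch serves v4 and v6, whose neighbours are v3 and v5. *)
pose f (v : P6_chord) : R := match val v with
  | 0%N => x1 | 1%N => (x1 + x3) / t | 2%N => x3 | 4%N => x5 | _ => (x3 + x5) / t end.
pose g (v : P6_chord) : R := f v / t.
have f0 v : 0 < f v.
  by rewrite /f; case: (val v) => [|[|[|[|[|?]]]]] //; rewrite divr_gt0 ?addr_gt0.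
apply: (@spectral_radius_le R _ t (@pendant_vector R P6_chord (at_v135 p q r) f g)).
- exact: ltW.
- by case=> [v|i] /=; rewrite ?divr_gt0.
case=> [v|i]; last by rewrite sum_nbr_pendant_leaf /= /g mulrC divfK ?gt_eqF.
rewrite sum_nbr_pendant_vector /=.
have nz : t != 0 by rewrite gt_eqF.
have tE (A B : R) : A <= t ^+ 2 * B -> A / t <= t * B.
  by rewrite ler_pdivrMr // expr2 mulrAC.
rewrite big_mkcond /= !big_ord_recl big_ord0 /g.
case: v => -[|[|[|[|[|[|v]]]]]] l //; rewrite /at_v135 /f /= !(add0r, addr0, mul0r).
- by apply: le_trans (tE _ _ h1); rewrite le_eqVlt; apply/orP; left; apply/eqP; field.
- by rewrite mulrC divfK.
- by apply: le_trans (tE _ _ h3); rewrite le_eqVlt; apply/orP; left; apply/eqP; field.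
- by rewrite mulrC divfK.
- by apply: le_trans (tE _ _ h5); rewrite le_eqVlt; apply/orP; left; apply/eqP; field.
- by rewrite mulrC divfK.
Qed.

End G2Upper.

Lemma G2_extremal (R : realType) (n : nat) (t : R) : 12 <= n -> (0 < t)%R ->
  (120 * t ^+ 2 = (40 * n + threshold_shift n)%:R)%R ->
  exists p q r, p + q + r + 6 = n /\ (spectral_radius R (G2 p q r) <= t)%R.
Proof.
move=> n12 t0 t2; pose m := n %/ 3.
have nE : n = m * 3 + n %% 3 by rewrite /m -divn_eq.
have m4 : 4 <= m by rewrite /m; lia.
have t2E : (120 * t ^+ 2 = 40 * (m%:R * 3 + (n %% 3)%:R) + (threshold_shift n)%:R)%R.
  by rewrite t2 natrD natrM {1}nE natrD natrM.
have mR k : k <= m -> ((m - k)%:R = m%:R - k%:R :> R)%R by move=> km; rewrite natrB.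
have [m2 m3 m4'] := And3 (mR 2 (ltnW (ltnW m4))) (mR 3 (ltnW m4)) (mR 4 m4).
have := ltn_pmod n (isT : 0 < 3).
(* The weights of v1, v3, v5 approximate the Perron vector; they are exact when
   3 divides n. *)
move: t2E nE; rewrite /threshold_shift; case: (n %% 3) => [|[|[|]]] //= T nE _.
- exists m, (m - 4), (m - 2); split=> //; first by lia.
  by apply: (@G2_spectral_radius_le _ _ _ _ _ 1 1 1); rewrite ?m2 ?m4' //; lra.
- exists m, (m - 3), (m - 2); split=> //; first by lia.
  by apply: (@G2_spectral_radius_le _ _ _ _ _ 30 42 35); rewrite ?m2 ?m3 //; lra.
- have m1 : ((m - 1)%:R = m%:R - 1 :> R)%R by rewrite natrB //; lia.
  exists (m + 1), (m - 4), (m - 1); split=> //; first by lia.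
  by apply: (@G2_spectral_radius_le _ _ _ _ _ 40 29 34); rewrite ?m4' ?m1 ?natrD //; lra.
Qed.

(** * Unicyclic graphs without a cover of three vertices *)

Section Structure.
Variable G : sgraph.

Definition is_cover (D : {set G}) : Prop :=
  forall x y, adj x y -> (x \in D) || (y \in D).

(** A smaller cover is padded with arbitrary further vertices, the hub analysis being written for
    exactly three. *)
Lemma cover_three_vertices (D : {set G}) : is_cover D -> #|D| <= 3 <= #|G| ->
  exists a b c : G, uniq [:: a; b; c] /\
    forall x y, adj x y -> (x \in [:: a; b; c]) || (y \in [:: a; b; c]).
Proof.
move=> cov /andP[D3 G3]; pose s := take 3 (enum D ++ enum (~: D)).
have us : uniq s.
  rewrite take_uniq // cat_uniq !enum_uniq andbT /=.
  by apply/hasPn => x; rewrite !mem_enum inE.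
have sz : size s = 3.
  by rewrite size_takel // size_cat -!cardE cardsC.
have sD x : x \in D -> x \in s.
  by move=> xD; rewrite /s take_cat -cardE ltnNge D3 /= mem_cat mem_enum xD.
case: s us sz sD => [|a [|b [|c [|]]]] // us _ sD; exists a, b, c; split=> // x y /cov.
by case/orP => /sD ->; rewrite ?orbT.
Qed.

Lemma connected_neighbor (x : G) : connected_graph G -> 1 < #|G| ->
  exists y, adj x y.
Proof.
move=> conn G1; have : 0 < #|[set~ x]| by rewrite cardsC1 -subn1 subn_gt0.
rewrite card_gt0 => /set0Pn[y]; rewrite !inE => yx.
have xW : x \in [set x] by rewrite inE.
have yW : y \notin [set x] by rewrite inE.
have [u [v [/set1P -> _ uv]]] := connected_boundary conn xW yW.
by exists v.
Qed.

(** Let C cover the forest and K cover the graph without s and t. A vertex outside both and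
    different from s, t sees only C and K in common. If K lies in C, the third vertex of C completes
    [s t] to a triangle; otherwise C and K share a single vertex, which carries almost the whole
    graph. *)
Lemma matching_three_structure :
  unicyclic G -> matching_number G = 3 -> 12 <= #|G| ->
  [\/ exists a b c : G, uniq [:: a; b; c] /\
        forall x y, adj x y -> (x \in [:: a; b; c]) || (y \in [:: a; b; c]),
      exists c : G, #|G| <= #|[set x | adj c x]| + 5 |
      exists a s t b c : G, [/\ uniq [:: a; s; t; b; c],
        [/\ adj a s, adj a t & adj s t] &
        forall x y, x \notin [:: a; s; t; b; c] -> adj x y -> y \in [:: b; c]]].
Proof.
have ar1 i j k u l g : i + j = 3 + k -> u + l = g -> u <= i + 2 -> k <= 2 ->
  g + j <= l + 7 by lia.
have ar2 g j l : 12 <= g -> g + j <= l + 7 -> 0 < l by lia.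
have ar3 g j l d : j = 1 -> g + j <= l + 7 -> 1 + l <= d -> g <= d + 5 by lia.
move=> uc m3 G12; have conn := uc.1.
have [s [t [st fr]]] := unicyclic_edge_forest uc.
have [smallcov|nocov] := pselect (exists2 D : {set G}, is_cover D & #|D| <= 3).
  have [D covD D3] := smallcov; constructor 1.
  by apply: (cover_three_vertices covD); rewrite D3 (leq_trans _ G12).
have st_neq : s != t by apply: contraTneq st => ->; rewrite adj_irrefl.
pose T (x y : G) := adj x y && ([set x; y] != [set s; t]).
have Tsym : symmetric T by move=> x y; rewrite /T adj_sym setUC.
have Tirr : irreflexive T by move=> x; rewrite /T adj_irrefl.
have Tadj ps : all (fun p : G * G => T p.1 p.2) ps -> all (fun p => adj p.1 p.2) ps.
  by apply: sub_all => p /andP[].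
have [C [ps [covT [_ aps] ups _ Cps]]] := konig_forest Tsym Tirr setT fr.
have C3 : #|C| <= 3.
  by apply: leq_trans Cps _; rewrite -m3 size_le_matching_number // Tadj.
have F1 x y : adj x y -> x \notin C -> y \notin C -> [set x; y] = [set s; t].
  move=> xy xC yC; apply/eqP; apply: contraT => ne.
  by have := covT x y (in_setT _) (in_setT _); rewrite /T xy ne (negPf xC) (negPf yC) => /(_ isT).
have sC : s \notin C.
  apply/negP => sC; apply: nocov; exists C => // x y xy.
  have [//|xC] := boolP (x \in C); apply: contraT => /= yC.
  by have /setP/(_ s) := F1 x y xy xC yC; rewrite !inE eqxx /= => /orP[]/eqP E;
     rewrite E ?(negPf xC) ?(negPf yC) in sC.
have tC : t \notin C.
  apply/negP => tC; apply: nocov; exists C => // x y xy.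
  have [//|xC] := boolP (x \in C); apply: contraT => /= yC.
  by have /setP/(_ t) := F1 x y xy xC yC; rewrite !inE eqxx orbT => /orP[]/eqP E;
     rewrite E ?(negPf xC) ?(negPf yC) in tC.
(* The deleted edge is the only one that can escape C, so adding [s] to a two-element C would give a
   small cover. *)
have C2 : 2 < #|C|.
  rewrite ltnNge; apply/negP => C2; apply: nocov; exists (s |: C).
    move=> x y xy; rewrite !inE; have [xC|xC] := boolP (x \in C); first by rewrite orbT.
    have [yC|yC] := boolP (y \in C); first by rewrite !orbT.
    by have /setP/(_ s) := F1 x y xy xC yC; rewrite !inE eqxx !orbF !(eq_sym s) => ->.
  by rewrite cardsU1 sC.
have {C2 C3} C3 : #|C| = 3 by apply/eqP; rewrite eqn_leq C3.
have [K [qs [covK [sK aqs] uqs sqs Kqs]]] := konig_forest Tsym Tirr (~: [set s; t]) fr.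
(* The edge [s t] extends any matching avoiding its ends. *)
have K2 : #|K| <= 2.
  have : size ((s, t) :: qs) <= 3.
    rewrite -m3; apply: size_le_matching_number; first by rewrite /= st Tadj.
    rewrite /= inE negb_or st_neq uqs andbT /=.
    by apply/andP; split; apply/negP => /sqs; rewrite !inE eqxx ?orbT.
  by rewrite /= ltnS; apply: leq_trans.
have sK' : s \notin K by apply/negP => /(subsetP sK); rewrite !inE eqxx.
have tK' : t \notin K by apply/negP => /(subsetP sK); rewrite !inE eqxx orbT.
have F2 x y : adj x y -> x \notin K -> y \notin K -> (x == s) || (x == t) || (y == s) || (y == t).
  move=> xy xK yK; apply: contraT; rewrite !negb_or -!andbA => /and4P[xs xt ys yt].
  have := covK x y; rewrite !inE !negb_or xs xt ys yt (negPf xK) (negPf yK) /T xy.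
  apply=> //=; apply: contraNneq xs => /setP/(_ x).
  by rewrite !inE eqxx (negPf xt) orbF => <-.
have [CK|CK] := leqP 2 #|C :&: K|.
  have KC : K \subset C.
    have : C :&: K == K by rewrite eqEcard subsetIr (leq_trans K2 CK).
    by move/eqP <-; apply: subsetIl.
  have {K2} K2 : #|K| = 2.
    apply/eqP; rewrite eqn_leq K2; apply: leq_trans CK _.
    by apply/subset_leq_card/subsetIr.
  have /cards1P[a aE] : #|C :\: K| == 1.
    by rewrite cardsD (setIidPr KC) C3 K2.
  have /eqP/cards2P[b [c [bc KE]]] := K2.
  have [aC aK] : a \in C /\ a \notin K.
    have : a \in C :\: K by rewrite aE inE.
    by rewrite inE => /andP[].
  have inC x : x \in C -> x = a \/ x \in K.
    move=> xC; have [xK|xK] := boolP (x \in K); first by right.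
    by left; apply/set1P; rewrite -aE inE xK.
  (* If [a] were not adjacent to [u], then [v |: K] would be a cover: an edge missed by it has the
     end [u], and its other end can be neither [a] nor outside C. *)
  have link u v : [set u; v] = [set s; t] -> u != v -> u \notin C -> u \notin K -> v \notin K ->
      adj a u.
    move=> E uv uC uK vK; apply: contraT => nau; case: nocov.
    have stE x : (x == s) || (x == t) = (x == u) || (x == v).
      by have /setP/(_ x) := E; rewrite !inE.
    exists (v |: K); last by rewrite cardsU1 vK K2.
    move=> x y xy; rewrite !inE; apply: contraT; rewrite !negb_or -!andbA.
    move=> /and4P[xv xK yv yK]; have := F2 x y xy xK yK.
    rewrite -orbA !stE (negPf xv) (negPf yv) !orbF.
    have aux w z : adj w z -> w = u -> z != v -> z \notin K -> False.
      move=> wz wE zv zK; rewrite wE in wz.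
      have [/inC[zE|zK']|zC] := boolP (z \in C).
      - by rewrite zE adj_sym (negPf nau) in wz.
      - by rewrite zK' in zK.
      - have := F1 u z wz uC zC; rewrite -E => /setP/(_ z).
        rewrite !inE eqxx orbT (negPf zv) orbF => /esym/eqP zE.
        by rewrite zE adj_irrefl in wz.
    by case/orP => /eqP E'; [case: (aux x y) | case: (aux y x)] => //; rewrite adj_sym.
  have ast : adj a s by apply: (link s t).
  have att : adj a t by apply: (link t s); rewrite // 1?setUC // eq_sym.
  constructor 3; exists a, s, t, b, c.
  have neq x y : x \in C -> y \notin C -> x != y by move=> xC yC; apply: contraNneq yC => <-.
  have bK : b \in K by rewrite KE !inE eqxx.
  have cK : c \in K by rewrite KE !inE eqxx orbT.
  have neqK x y : x \in K -> y \notin K -> y != x by move=> xK yK; apply: contraNneq yK => ->.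
  split=> //.
    rewrite /= !inE !negb_or (neq a s) // (neq a t) // st_neq bc.
    by rewrite (neqK b a) // (neqK c a) // (neqK b s) // (neqK c s) // (neqK b t) // (neqK c t).
  move=> x y xS xy; move: xS; rewrite !inE !negb_or => /and5P[xa xs xt xb xc].
  have xK : x \notin K by rewrite KE !inE negb_or xb.
  have xC : x \notin C by apply/negP => /inC[] xE; [rewrite xE eqxx in xa | rewrite xE in xK].
  have [/inC[yE|]|yC] := boolP (y \in C).
  - have := F2 x y xy xK; rewrite yE aK (negPf xs) (negPf xt) => /(_ isT) /=.
    by rewrite (negPf (neq _ _ aC sC)) (negPf (neq _ _ aC tC)).
  - by rewrite KE !inE.
  - have /setP/(_ x) := F1 x y xy xC yC.
    by rewrite !inE eqxx (negPf xs) (negPf xt).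
(* The union of C and K has at most 5 - |C :&: K| elements, so L omits at most 7 - |C :&: K|
   vertices. *)
pose L := ~: (C :|: K :|: [set s; t]).
have Lnbr x y : x \in L -> adj x y -> y \in C :&: K.
  rewrite !inE !negb_or -!andbA => /and4P[xC xK xs xt] xy.
  have yC : y \in C.
    apply: contraT => yC; have /setP/(_ x) := F1 x y xy xC yC.
    by rewrite !inE eqxx (negPf xs) (negPf xt).
  rewrite yC /=; apply: contraT => yK; have := F2 x y xy xK yK.
  rewrite (negPf xs) (negPf xt) /= => /orP[]/eqP yE.
    by rewrite yE (negPf sC) in yC.
  by rewrite yE (negPf tC) in yC.
have Lcard : #|G| + #|C :&: K| <= #|L| + 7.
  have UI : #|C :|: K| + #|C :&: K| = 3 + #|K| by rewrite cardsUI C3.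
  apply: ar1 UI (cardsC (C :|: K :|: [set s; t])) _ K2.
  by apply: leq_trans (leq_card_setU _ _) _; rewrite cards2 st_neq.
have [x xL] : exists x, x \in L by apply/set0Pn; rewrite -card_gt0; exact: ar2 G12 Lcard.
have [y xy] := connected_neighbor x conn (leq_trans (isT : 1 < 12) G12).
have cK := Lnbr x y xL xy; move: y cK {xy} => c cCK.
have /eqP CK1 : #|C :&: K| == 1 by rewrite eqn_leq -ltnS CK card_gt0; apply/set0Pn; exists c.
have CKE z : z \in C :&: K -> z = c.
  move=> zCK; move: CK1 => /eqP/cards1P[w wE].
  by move: zCK cCK; rewrite wE => /set1P -> /set1P ->.
have Lc z : z \in L -> adj c z.
  move=> zL; have [w zw] := connected_neighbor z conn (leq_trans (isT : 1 < 12) G12).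
  by rewrite adj_sym -(CKE w) //; apply: Lnbr zw.
have sW : s \notin c |: L.
  by rewrite !inE eqxx !orbT orbF; apply: contraNneq sC => ->; move: cCK; rewrite inE => /andP[].
(* L has at least n - 6 vertices, all adjacent to [c]; the path towards [s] supplies one more
   neighbour, whence n - 5. *)
have [u [v [uW vW uv]]] := connected_boundary conn (setU11 c L) sW.
have uc' : u = c.
  move: uW; rewrite in_setU1 => /orP[/eqP //|uL].
  by move: vW; rewrite (CKE v (Lnbr u v uL uv)) setU11.
constructor 2; exists c.
have : #|v |: L| <= #|[set x | adj c x]|.
  apply/subset_leq_card/subsetP => z; rewrite in_setU1 inE => /orP[/eqP ->|/Lc //].
  by rewrite -uc'.
have vL : v \notin L by move: vW; rewrite in_setU1 negb_or => /andP[].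
by rewrite cardsU1 vL; apply: ar3 CK1 Lcard.
Qed.

End Structure.

Section DegreeBound.
Local Open Scope ring_scope.

(** Weight [t] at [c] and 1 at its d neighbours gives 2td <= t(t^2 + d), already from the star at
    [c]. *)
Lemma degree_le_sqr (R : realType) (G : sgraph) (c : G) (t : R) : 0 < t ->
  spectral_radius R G <= t -> #|[set x | adj c x]|%:R <= t ^+ 2.
Proof.
move=> t0 rt; set d := #|_|.
pose z (x : G) : R := if x == c then t else (adj c x)%:R.
have z0 x : 0 <= z x by rewrite /z; case: ifP => _; [exact: ltW | exact: ler0n].
have zc : z c = t by rewrite /z eqxx.
have z1 x : adj c x -> z x = 1.
  by move=> cx; rewrite /z cx; case: eqP cx => // ->; rewrite adj_irrefl.
have sumd : \sum_(x | adj c x) (1 : R) = d%:R.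
  by rewrite sumr_const; congr (_%:R); apply: eq_card => x; rewrite inE.
have low : 2 * (t * d%:R) <= \sum_x \sum_(y | adj x y) z x * z y.
  rewrite (bigD1 c) //= mulr_natl mulr2n; apply: lerD.
    rewrite -mulr_sumr zc ler_wpM2l ?(ltW t0) // -sumd.
    by apply: ler_sum => x cx; rewrite z1.
  rewrite -sumd mulr_sumr [leRHS]big_mkcond [leLHS]big_mkcond /=.
  apply: ler_sum => x _; have [->|xc] := eqVneq x c; first by rewrite adj_irrefl.
  have inner0 : 0 <= \sum_(y | adj x y) z x * z y.
    by apply: sumr_ge0 => y _; rewrite mulr_ge0.
  case: ifP => // cx; rewrite (bigD1 c) 1?adj_sym //= z1 // zc mul1r mulr1 lerDl.
  by apply: sumr_ge0 => y _; rewrite mul1r.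
have sq : \sum_x z x ^+ 2 = t ^+ 2 + d%:R.
  rewrite (bigD1 c) //= zc -sumd; congr (_ + _).
  rewrite big_mkcond [RHS]big_mkcond; apply: eq_bigr => x _.
  have [->|xc] /= := eqVneq x c; first by rewrite adj_irrefl.
  by rewrite /z (negPf xc); case: adj; rewrite ?expr1n ?expr0n.
have := le_trans low (rayleigh_le_spectral_radius z); rewrite sq => up.
have : 2 * (t * d%:R) <= t * (t ^+ 2 + d%:R).
  apply: le_trans up _; apply: ler_wpM2r rt.
  by rewrite addr_ge0 ?sqr_ge0.
by rewrite mulrCA ler_pM2l // mulr_natl mulr2n lerD2r.
Qed.

End DegreeBound.

(** * A triangle together with two hubs *)

Section Triangle.
Variables (G : sgraph) (a s t b c : G).
Hypotheses (five : uniq [:: a; s; t; b; c]).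
Hypotheses (adj_as : adj a s) (adj_at : adj a t) (adj_st : adj s t).
Hypothesis outer : forall x y, x \notin [:: a; s; t; b; c] -> adj x y -> y \in [:: b; c].

Lemma sum_five (V : nmodType) (F : G -> V) :
  (\sum_x F x = F a + (F s + (F t + (F b + F c)))
                + \sum_(x | x \notin [:: a; s; t; b; c]) F x)%R.
Proof.
rewrite (bigID (mem [:: a; s; t; b; c])) /= -big_uniq //=.
by rewrite !big_cons big_nil addr0.
Qed.

Definition link_count (x : G) : nat := adj x b + adj x c.
Definition triangle_links : nat := link_count a + link_count s + link_count t.

Lemma sum_outer_nbr (V : nmodType) (F : G -> V) (x : G) :
  x \notin [:: a; s; t; b; c] ->
  (\sum_(y | adj x y) F y = F b *+ adj x b + F c *+ adj x c)%R.
Proof.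
move=> xS; rewrite big_mkcond sum_five big1 ?addr0; last first.
  move=> y yS; case: ifP => // /(outer xS); move: yS; rewrite !inE !negb_or.
  by case/and5P => _ _ _ /negPf -> /negPf ->.
have no h : h \in [:: a; s; t] -> adj x h = false.
  move=> hh; apply/negbTE/negP => /(outer xS) hbc.
  have : uniq ([:: a; s; t] ++ [:: b; c]) := five.
  by rewrite cat_uniq => /and3P[_ /hasPn/(_ h hbc)]; rewrite /= hh.
rewrite (no a) ?(no s) ?(no t) ?inE ?eqxx ?orbT //= !add0r.
by case: adj; case: adj; rewrite ?mulr1n ?mulr0n.
Qed.

(** The outer vertices see only [b] and [c], hence are independent. Both hubs get weight 1, and the
    triangle weights stay free. *)
Lemma triangle_rayleigh (R : realType) (r ya ys yt : R) :
  (0 < r -> spectral_radius R G <= r ->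
   \sum_(x | x \notin [:: a; s; t; b; c]) (link_count x)%:R ^+ 2
   + r * (2 * (ya * ys + ya * yt + ys * yt + (adj b c)%:R + ya * (link_count a)%:R
               + ys * (link_count s)%:R + yt * (link_count t)%:R))
   <= r ^+ 2 * (ya ^+ 2 + ys ^+ 2 + yt ^+ 2 + 2))%R.
Proof.
move=> r0 rr.
pose x u : R := if u == a then ya else if u == s then ys else if u == t then yt else
                if u == b then 1%R else if u == c then 1%R else 0%R.
have [xa xs xt xb xc] : [/\ x a = ya, x s = ys, x t = yt, x b = 1%R & x c = 1%R].
  move: five; rewrite /x /= !inE !negb_or !andbT.
  move=> /and4P[/and4P[as_ at_ ab ac] /and3P[st sb sc] /andP[tb tc] bc].
  rewrite !eqxx !(eq_sym s) !(eq_sym t) !(eq_sym b) !(eq_sym c).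
  by rewrite !(negPf as_, negPf at_, negPf ab, negPf ac, negPf st, negPf sb, negPf sc,
              negPf tb, negPf tc, negPf bc).
have xS u : u \notin [:: a; s; t; b; c] -> x u = 0%R.
  by rewrite /x !inE !negb_or => /and5P[/negPf -> /negPf -> /negPf -> /negPf -> /negPf ->].
have indep : {in [set u | u \notin [:: a; s; t; b; c]] &, forall u v, ~~ adj u v}.
  move=> u v; rewrite !in_set => uS vS; apply: contra vS => /(outer uS).
  by rewrite !inE => /orP[] ->; rewrite !orbT.
have xS0 : {in [set u | u \notin [:: a; s; t; b; c]], forall u, x u = 0%R}.
  by move=> u; rewrite in_set; exact: xS.
have := independent_rayleigh r0 rr indep xS0.
rewrite (eq_bigl (fun u => u \notin [:: a; s; t; b; c])) => [|u]; last by rewrite in_set.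
rewrite (eq_bigr (fun u => ((link_count u)%:R ^+ 2)%R)); last first.
  by move=> u uS; rewrite sum_outer_nbr // xb xc natrD.
have hub h : (\sum_(v | adj h v) x h * x v
   = x h * ((adj h a)%:R * ya + (adj h s)%:R * ys + (adj h t)%:R * yt
            + (link_count h)%:R))%R.
  rewrite -mulr_sumr big_mkcond sum_five big1 ?addr0.
    rewrite xa xs xt xb xc /link_count natrD !addrA.
    by do 5![case: adj; rewrite ?mul1r ?mul0r].
  by move=> y yS; rewrite xS // if_same.
have edges0 : (\sum_(u | u \notin [:: a; s; t; b; c])
                 \sum_(v | adj u v) x u * x v = 0)%R.
  by apply: big1 => u uS; apply: big1 => v _; rewrite xS // mul0r.
have squares0 : (\sum_(u | u \notin [:: a; s; t; b; c]) x u ^+ 2 = 0)%R.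
  by apply: big1 => u uS; rewrite xS // expr0n.
rewrite (sum_five (fun u => \sum_(v | adj u v) x u * x v)%R) edges0 !hub.
rewrite (sum_five (fun u => x u ^+ 2)%R) squares0 xa xs xt xb xc !addr0.
rewrite /link_count !adj_irrefl !(adj_sym s a) !(adj_sym t a) !(adj_sym t s) adj_as adj_at adj_st.
rewrite !(adj_sym b) !(adj_sym c) !natrD /= !mulr0n.
move=> h; apply: le_trans (le_trans _ h) _; last first.
  by rewrite le_eqVlt; apply/orP; left; apply/eqP; ring.
rewrite le_eqVlt; apply/orP; left; apply/eqP; congr (_ + _)%R; ring.
Qed.

Lemma sum_degrees_triangle : \sum_(x : G) \sum_(y : G) adj x y
  = 2 * (3 + adj b c + triangle_links
         + \sum_(x | x \notin [:: a; s; t; b; c]) link_count x).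
Proof.
have hub h : \sum_(y : G) adj h y = adj h a + (adj h s + (adj h t + (adj h b + adj h c)))
               + \sum_(y | y \notin [:: a; s; t; b; c]) adj y h.
  by rewrite sum_five; congr (_ + _); apply: eq_bigr => y _; rewrite adj_sym.
have none h : h \in [:: a; s; t] -> \sum_(y | y \notin [:: a; s; t; b; c]) adj y h = 0.
  move=> hh; apply: big1 => y yS; case yh: (adj y h) => //.
  have hbc := outer yS yh; have : uniq ([:: a; s; t] ++ [:: b; c]) := five.
  by rewrite cat_uniq => /and3P[_ /hasPn/(_ h hbc)]; rewrite /= hh.
have rest : \sum_(x | x \notin [:: a; s; t; b; c]) \sum_(y : G) adj x y
            = \sum_(x | x \notin [:: a; s; t; b; c]) link_count x.
  apply: eq_bigr => x xS; transitivity (\sum_(y | adj x y) 1).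
    by rewrite [RHS]big_mkcond; apply: eq_bigr => y _; case: adj.
  by rewrite (sum_outer_nbr (fun=> 1)) // !natn.
have back : \sum_(x | x \notin [:: a; s; t; b; c]) adj x b
            + \sum_(x | x \notin [:: a; s; t; b; c]) adj x c
            = \sum_(x | x \notin [:: a; s; t; b; c]) link_count x.
  by rewrite -big_split.
rewrite sum_five rest -back !hub !(none a, none s, none t) ?inE ?eqxx ?orbT //.
rewrite /triangle_links /link_count !adj_irrefl !(adj_sym s a) !(adj_sym t a) !(adj_sym t s).
rewrite !(adj_sym b) !(adj_sym c) adj_as adj_at adj_st.
move: (\sum_(x | _) adj x b) (\sum_(x | _) adj x c) => B C.
by clear; lia.
Qed.

End Triangle.

Section TriangleArithmetic.
Local Open Scope ring_scope.

(* For r large the vector vanishing on the triangle suffices; otherwise it is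
   close to the top eigenvector of the triangle, tilted towards its links. *)
Lemma triangle_estimate (R : realType) (r : R) (da ds dt D2 D1 m n : nat) (k : bool) :
  (0 < da + ds + dt)%N -> (m <= D2)%N -> (3 * D1 <= D2 + 2 * m)%N ->
  (n <= 3 + k + (da + ds + dt) + D1)%N -> n = (5 + m)%N ->
  12 / 5 <= r -> 120 * r ^+ 2 <= 40 * n%:R + 248 ->
  ~ (forall ya ys yt : R,
   D2%:R + r * (2 * (ya * ys + ya * yt + ys * yt + k%:R + ya * da%:R
                     + ys * ds%:R + yt * dt%:R))
   <= r ^+ 2 * (ya ^+ 2 + ys ^+ 2 + yt ^+ 2 + 2)).
Proof.
move=> links mD2 D12 nD1 nE r_ge r2 ray.
have nR : n%:R = 5 + m%:R :> R by rewrite nE natrD.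
have mD2R : m%:R <= D2%:R :> R by rewrite ler_nat.
have r_ge0 : 0 <= r by lra.
have rk : 0 <= r * k%:R by rewrite mulr_ge0.
(* Zero weights give n - 5 <= 2r^2, while n >= 3r^2 - 31/5; so r^2 <= 56/5 < (67/20)^2. *)
have r_le : r <= 67 / 20.
  have := ray 0 0 0; rewrite !mul0r !add0r !addr0 expr0n /= !add0r => ray0.
  by nra.
(* Each remaining bound would need a convex quadratic in [r] that is negative at both ends of this
   interval to be nonnegative inside it; [r_box] lets [lra] see the contradiction. *)
have r_box : 0 <= (r - 12 / 5) * (67 / 20 - r) by apply: mulr_ge0; lra.
have [links2|links1] := ltnP 1 (da + ds + dt).
  have l2 : 2 <= da%:R + ds%:R + dt%:R :> R by rewrite -!natrD (ler_nat R 2).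
  have rl : 0 <= r * (da%:R + ds%:R + dt%:R - 2) by apply: mulr_ge0; lra.
  by have := ray (4 / 5) (4 / 5) (4 / 5); lra.
(* With a single link, having at least n edges requires either the edge [b c], worth 2r > 3, or an
   outer vertex seeing both hubs, which contributes 4 instead of 1 to D2. *)
have low : n%:R <= D2%:R + 2 * (r * k%:R) + 2.
  case: k nD1 {ray rk} => nD1; first by rewrite mulr1; lra.
  have : (n <= D2 + 2)%N by lia.
  by rewrite -(ler_nat R) natrD mulr0n mulr0; lra.
have [[daE [dsE dtE]]|[[daE [dsE dtE]]|[daE [dsE dtE]]]] :
  (da = 1 /\ ds = 0 /\ dt = 0 \/ da = 0 /\ ds = 1 /\ dt = 0
   \/ da = 0 /\ ds = 0 /\ dt = 1)%N by clear -links links1; lia.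
- by have := ray 1 (2 / 3) (2 / 3); rewrite daE dsE dtE; lra.
- by have := ray (2 / 3) 1 (2 / 3); rewrite daE dsE dtE; lra.
- by have := ray (2 / 3) (2 / 3) 1; rewrite daE dsE dtE; lra.
Qed.

End TriangleArithmetic.

Section TriangleCase.
Variables (R : realType) (G : sgraph) (a s t b c : G) (r : R).

Lemma triangle_case_absurd : uniq [:: a; s; t; b; c] ->
  adj a s -> adj a t -> adj s t ->
  (forall x y, x \notin [:: a; s; t; b; c] -> adj x y -> y \in [:: b; c]) ->
  unicyclic G -> 12 <= #|G| -> (0 < r)%R -> (12 / 5 <= r)%R ->
  (120 * r ^+ 2 <= 40 * #|G|%:R + 248)%R ->
  (spectral_radius R G <= r)%R -> False.
Proof.
move=> five as_ at_ st outer uc G12 r0 r_ge r2 rr.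
have ray := triangle_rayleigh five as_ at_ st outer _ _ _ r0 rr.
have edges_ge := unicyclic_sum_degrees uc.
rewrite (sum_degrees_triangle five as_ at_ st outer) leq_mul2l /= in edges_ge.
have cardG : #|G| = 5 + \sum_(x | x \notin [:: a; s; t; b; c]) 1.
  by rewrite -sum1_card (sum_five five (fun=> 1)).
(* By connectedness an edge leaves the triangle, and it must end in [b] or [c], since outer vertices
   see only these. *)
have links : 0 < triangle_links a s t b c.
  have aW : a \in [set a; s; t] by rewrite !inE eqxx.
  have bW : b \notin [set a; s; t].
    move: five; rewrite /= !inE !negb_or -!(eq_sym b).
    by case/and5P => /and4P[_ _ -> _] /and3P[_ -> _] /andP[-> _].
  have [u [v [uW vW uv]]] := connected_boundary uc.1 aW bW.
  have uW' : u \in [:: a; s; t] by move: uW; rewrite !inE -orbA.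
  have vbc : v \in [:: b; c].
    have [|vS] := boolP (v \in [:: a; s; t; b; c]).
      by move: vW; rewrite !inE !negb_or => /andP[/andP[/negPf -> /negPf ->] /negPf ->].
    have ubc : u \in [:: b; c] by apply: outer vS _; rewrite adj_sym.
    have : uniq ([:: a; s; t] ++ [:: b; c]) := five.
    by rewrite cat_uniq => /and3P[_ /hasPn/(_ u ubc)]; rewrite /= uW'.
  have lu : 0 < link_count b c u.
    rewrite /link_count; move: vbc; rewrite !inE => /orP[]/eqP <-; rewrite uv //.
    by rewrite addnC.
  rewrite /triangle_links; move: uW' lu; rewrite !inE => /or3P[]/eqP ->;
    by move: (link_count b c a) (link_count b c s) (link_count b c t); clear; lia.
have sq_ge : \sum_(x | x \notin [:: a; s; t; b; c]) 1
    <= \sum_(x | x \notin [:: a; s; t; b; c]) link_count b c x ^ 2.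
  apply: leq_sum => x xS; rewrite expn_gt0 orbF.
  have [y xy] := connected_neighbor x uc.1 (leq_trans (isT : 1 < 12) G12).
  have := outer x y xS xy; rewrite /link_count !inE => /orP[]/eqP <-; rewrite xy //.
  by rewrite addnC.
(* Termwise this is (d - 1)(d - 2) >= 0 for d the number of hubs seen. *)
have sq_ge3 : 3 * \sum_(x | x \notin [:: a; s; t; b; c]) link_count b c x
    <= \sum_(x | x \notin [:: a; s; t; b; c]) link_count b c x ^ 2
       + 2 * \sum_(x | x \notin [:: a; s; t; b; c]) 1.
  rewrite !big_distrr -big_split /=; apply: leq_sum => x _.
  by rewrite /link_count; do 2!case: adj.
have sqR : (\sum_(x | x \notin [:: a; s; t; b; c]) (link_count b c x)%:R ^+ 2
   = (\sum_(x | x \notin [:: a; s; t; b; c]) link_count b c x ^ 2)%:R :> R)%R.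
  by rewrite natr_sum; apply: eq_bigr => x _; rewrite natrX.
rewrite sqR in ray.
move: sq_ge sq_ge3 ray edges_ge cardG.
move: (\sum_(x | _) _ ^ 2) (\sum_(x | _) link_count b c x) (\sum_(x | _) 1).
move: links; rewrite /triangle_links.
move: (link_count b c a) (link_count b c s) (link_count b c t).
move=> da ds dt links D2 D1 m mD2 D12 ray edges_ge cardG.
exact: (triangle_estimate links mD2 D12 edges_ge cardG r_ge r2 ray).
Qed.

End TriangleCase.

(** * Identification of the minimiser from its hub profile *)

Lemma G2_graph_iso (G : sgraph) (a b c : G) (p q r : nat) :
  uniq [:: a; b; c] ->
  (forall x y, adj x y -> (x \in [:: a; b; c]) || (y \in [:: a; b; c])) ->
  hub_profile a b c q p r 1 2 0 -> graph_iso G (G2 p q r).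
Proof.
move=> u cov prof.
by apply: (profile_graph_iso u _ cov _ prof (G2_profile p q r)) => //; exact: G2_cover.
Qed.

Lemma G3_graph_iso (G : sgraph) (a b c : G) (p q r : nat) :
  uniq [:: a; b; c] ->
  (forall x y, adj x y -> (x \in [:: a; b; c]) || (y \in [:: a; b; c])) ->
  hub_profile a b c p q r 1 1 1 -> graph_iso G (G3 p q r).
Proof.
move=> u cov prof.
by apply: (profile_graph_iso u _ cov _ prof (G3_profile p q r)) => //; exact: G3_cover.
Qed.

Theorem theorem3p33 (R : realType) (n : nat) (G : sgraph)
    (hn : 12 <= n)
    (hG : min_spectral_radius R (unicyclic_class n 3) G) :
  [/\ n = 2 %[mod 3] ->
        graph_iso G (G2 ((n + 1) %/ 3) ((n - 14) %/ 3) ((n - 5) %/ 3)),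
      n = 0 %[mod 3] ->
        graph_iso G (G2 (n %/ 3) ((n - 12) %/ 3) ((n - 6) %/ 3)) \/
        graph_iso G (G3 ((n - 6) %/ 3) ((n - 6) %/ 3) ((n - 6) %/ 3))
    & n = 1 %[mod 3] ->
        graph_iso G (G2 ((n - 1) %/ 3) ((n - 10) %/ 3) ((n - 7) %/ 3))].
Proof.
have [[uc Gn m3] Gmin] := hG.
pose t : R := Num.sqrt ((40 * n + threshold_shift n)%:R / 120)%R.
have num0 : (0 < (40 * n + threshold_shift n)%:R / 120 :> R)%R.
  by rewrite divr_gt0 // ltr0n addn_gt0 muln_gt0 /= (leq_trans _ hn).
have t0 : (0 < t)%R by rewrite sqrtr_gt0.
have t2 : (120 * t ^+ 2 = (40 * n + threshold_shift n)%:R)%R.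
  by rewrite sqr_sqrtr ?ltW // mulrC divfK // pnatr_eq0.
have rt : (spectral_radius R G <= t)%R.
  have [p [q [r [pqr rt]]]] := G2_extremal hn t0 t2.
  by apply: le_trans (Gmin _ _) rt; rewrite -pqr; exact: G2_class.
have shift := threshold_shift_bounds n.
have t2_le : (120 * t ^+ 2 <= 40 * n%:R + 248)%R.
  by rewrite t2 natrD natrM lerD2l ler_nat; case/andP: shift.
have t_ge : (12 / 5 <= t)%R.
  have n12 : (12%:R <= n%:R :> R)%R by rewrite ler_nat.
  have s240 : (240%:R <= (threshold_shift n)%:R :> R)%R.
    by rewrite ler_nat; case/andP: shift.
  by move: t2; rewrite natrD natrM; nra.
have n12 : 12 <= #|G| by rewrite Gn.
have [[a [b [c [u cov]]]]|[c degc]|[a [s [u [b [c [five [as_ au su] outer]]]]]]] :=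
  matching_three_structure uc m3 n12.
- rewrite -Gn in t2.
  have [a' [b' [c' [u' cov' prof]]]] := three_cover_profile u cov n12 uc t0 t2 rt.
  rewrite Gn in prof; split=> nmod; rewrite nmod /= in prof.
  (* A number at least 12 and congruent to 2 modulo 3 is at least 14, so no subtraction is
     truncated. *)
  + apply: G2_graph_iso u' cov' _; have nE := divn_eq n 3; rewrite nmod in nE.
    rewrite (_ : (n - 14) %/ 3 = n %/ 3 - 4); last by lia.
    rewrite (_ : (n + 1) %/ 3 = n %/ 3 + 1); last by lia.
    by rewrite (_ : (n - 5) %/ 3 = n %/ 3 - 1); last by lia.
  + have -> : (n - 12) %/ 3 = n %/ 3 - 4 by lia.
    have -> : (n - 6) %/ 3 = n %/ 3 - 2 by lia.
    by case: prof => prof; [left; apply: G2_graph_iso prof | right; apply: G3_graph_iso prof].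
  + apply: G2_graph_iso u' cov' _.
    rewrite (_ : (n - 10) %/ 3 = n %/ 3 - 3); last by lia.
    rewrite (_ : (n - 1) %/ 3 = n %/ 3); last by lia.
    by rewrite (_ : (n - 7) %/ 3 = n %/ 3 - 2); last by lia.
(* The bounds n - 5 <= t^2 <= n/3 + 31/15 are incompatible for n >= 11. *)
- have deg := degree_le_sqr c t0 rt.
  have : (n%:R <= #|[set x | adj c x]|%:R + 5 :> R)%R by rewrite -natrD ler_nat -Gn.
  have : (12%:R <= n%:R :> R)%R by rewrite ler_nat.
  by lra.
- exfalso; apply: (triangle_case_absurd five as_ au su outer uc n12 t0 t_ge _ rt).
  by rewrite Gn.
Qed.
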